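(* Let $n\ge1$ and let $[\mathbf i_0]$ be any twisted adapted class of type $A_{2n+1}$, with $\Phi^+$ the positive roots and $\Pi$ the simple roots of type $A_{2n+1}$. (1) For any pair $(\alpha,\beta)$ of positive roots, $$\mathrm{gdist}_{[\mathbf i_0]}(\alpha,\beta)\le\max\{\overline{\mathsf m}(\gamma)\mid\gamma\in\Phi^+\}=2 .$$ (2) For any $\gamma\in\Phi^+\setminus\Pi$, $\mathrm{rds}_{[\mathbf i_0]}(\gamma)\le2$. In particular, $\mathrm{rds}_{[\mathbf i_0]}(\gamma)=2$ implies $\overline{\mathsf m}(\gamma)=2$. (3) For any pair $\underline p$, the socle $\mathrm{soc}_{[\mathbf i_0]}(\underline p)$ is well-defined.
   Context: Let $I=\{1,\dots,2n+1\}$, $W$ the Weyl group of type $A_{2n+1}$ with simple reflections $s_i$, simple roots $\alpha_i$, longest element $w_0$ of length $N$. Reduced words of $w_0$ are commutation equivalent if related by swapping neighbouring letters $i,j$ with $|i-j|\ge2$; $[\mathbf i]$ is the commutation class. An index $i$ is a sink (resp. source) of $[\mathbf i]$ if some word in the class starts (resp. ends) with $i$. With $i^*=2n+2-i$, reflection functors are: if $i$ is a sink and $i\,i_2\cdots i_N\in[\mathbf i]$, $[\mathbf i]r_i=[i_2\cdots i_N\,i^*]$; if $i$ is a source and $i_1\cdots i_{N-1}i\in[\mathbf i]$, $r_i[\mathbf i]=[i^*i_1\cdots i_{N-1}]$; otherwise the class is unchanged. Put $i^\vee=2n+2-i$; $(\cdot)^{k\vee}$ applies $\vee$ letterwise $k$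 times. A class is twisted adapted if it is obtained by a sequence of reflection functors from the class of the reduced word $\prod_{k=0}^{2n}(1\,2\cdots n{+}1)^{k\vee}$ of $w_0$. For a reduced word $\mathbf j=i_1\cdots i_N$ of $w_0$ put $\beta^{\mathbf j}_k=s_{i_1}\cdots s_{i_{k-1}}(\alpha_{i_k})$, so $\Phi^+=\{\beta^{\mathbf j}_1,\dots,\beta^{\mathbf j}_N\}$. A sequence is a function $\underline m:\Phi^+\to\mathbb Z_{\ge0}$; its weight is $\mathrm{wt}(\underline m)=\sum_\beta\underline m(\beta)\beta$. A pair $\underline p=(\alpha,\beta)$ is a sequence taking value $1$ on two distinct roots $\alpha,\beta$ and $0$ elsewhere. A single root $\gamma$ is viewed as the sequence with value $1$ at $\gamma$ and $0$ elsewhere. Write $\underline m'<^{\mathtt b}_{\mathbf j}\underline m$ if there are $1\le k\le s\le N$ with $\underline m'(\beta^{\mathbf j}_t)=\underline m(\beta^{\mathbf j}_t)$ for $t<k$ and for $t>s$, $\underline m'(\beta^{\mathbf j}_k)<\underline m(\beta^{\mathbf j}_k)$ and $\underline m'(\beta^{\mathbf j}_s)<\underline m(\beta^{\mathbf j}_s)$. Write $\underline m'\prec^{\mathtt b}_{[\mathbf i_0]}\underline m$ if $\underline m'<^{\mathtt b}_{\mathbf j}\underline m$ for all $\mathbf j\in[\mathbf i_0]$. A pair $\underline p$ is $[\mathbf i_0]$-simple if there is no sequence $\underline m\prec^{\mathtt b}_{[\mathbf i_0]}\underline p$ with $\mathrm{wt}(\underline m)=\mathrm{wt}(\underline p)$.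 A sequence is $[\mathbf i_0]$-simple if it is supported on a single root or if every pair of distinct roots in its support is an $[\mathbf i_0]$-simple pair. $\mathrm{gdist}_{[\mathbf i_0]}(\underline m)$ is $0$ if $\underline m$ is $[\mathbf i_0]$-simple, and otherwise is the maximal $k$ such that there exist non-$[\mathbf i_0]$-simple sequences $\underline m^{(1)}\prec^{\mathtt b}_{[\mathbf i_0]}\cdots\prec^{\mathtt b}_{[\mathbf i_0]}\underline m^{(k)}=\underline m$, all of weight $\mathrm{wt}(\underline m)$. For $\gamma\in\Phi^+\setminus\Pi$, $\mathrm{rds}_{[\mathbf i_0]}(\gamma)=\max\{\mathrm{gdist}_{[\mathbf i_0]}(\underline p)\mid\underline p\text{ a pair},\ \gamma\prec^{\mathtt b}_{[\mathbf i_0]}\underline p,\ \mathrm{wt}(\underline p)=\gamma\}$. The socle $\mathrm{soc}_{[\mathbf i_0]}(\underline p)$ of a pair is the $[\mathbf i_0]$-simple sequence $\underline s$ with $\mathrm{wt}(\underline s)=\mathrm{wt}(\underline p)$ and $\underline s\preceq^{\mathtt b}_{[\mathbf i_0]}\underline p$, if such $\underline s$ exists uniquely (''well-defined'' means that it exists and is unique). The folded multiplicity of $\gamma=\sum_i m_i\alpha_i\in\Phi^+$ is $\overline{\mathsf m}(\gamma)=\max_{\bar i}\sum_{j\in\bar i}m_j$, where $\bar i=\{i,2n+2-i\}$ runs over the $\vee$-orbits in $I$. *)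

(* Defs.v *)
From mathcomp Require Import all_boot all_order all_algebra.
From mathcomp Require Import zify.

Set Implicit Arguments.
Unset Strict Implicit.
Unset Printing Implicit Defensive.

Import GRing.Theory.
Local Open Scope ring_scope.

(* The index i in {1,...,2n+1} is represented by the ordinal of value i - 1. *)
Notation index n := 'I_(n.*2.+1).
Notation word n := (seq (index n)).

(* Elements of the root lattice are given by their coordinates in the basis   *)
(* of simple roots.                                                           *)
Notation lattice n := 'rV[int]_(n.*2.+1).

Definition far n (i j : index n) : bool := (i.+1 < j)%N || (j.+1 < i)%N.

Definition cartan n (i j : index n) : int :=
  if i == j then 2 else if far i j then 0 else -1.

Definition alpha n (i : index n) : lattice n := delta_mx 0 i.

Definition refl n (i : index n) (v : lattice n) : lattice n :=
  v - (\sum_j v 0 j * cartan i j) *: alpha i.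

(* The action of s_{i_1} ... s_{i_l}.  The Weyl group is the group of these   *)
(* transformations, so two words represent the same element of W iff their   *)
(* actions coincide.                                                          *)
Definition act n (j : word n) (v : lattice n) : lattice n :=
  foldr (@refl n) v j.

Definition reduced n (j : word n) : Prop :=
  forall j' : word n, act j' =1 act j -> (size j <= size j')%N.

Definition reduced_w0 n (j : word n) : Prop :=
  reduced j /\ forall j' : word n, reduced j' -> (size j' <= size j)%N.

(* The positive roots alpha_a + ... + alpha_b, for a <= b.                    *)
Notation posroot n := {p : index n * index n | (p.1 <= p.2)%N}.

Definition coef n (g : posroot n) (i : index n) : nat :=
  ((val g).1 <= i <= (val g).2)%N.

Definition root n (g : posroot n) : lattice n :=
  \sum_(i < n.*2.+1) alpha i *+ coef g i.

Definition is_simple_root n (g : posroot n) : Prop :=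
  exists i : index n, root g = alpha i.

(* This map is both i |-> i^* and i |-> i^\vee, which coincide here.          *)
Definition dual n (i : index n) : index n := rev_ord i.

Definition folded_mult n (g : posroot n) : nat :=
  \max_(i < n.*2.+1) \sum_(j in [set i; dual i]) coef g j.

Definition max_folded_mult n : nat := \max_(g : posroot n) folded_mult g.

(* The commutation class [i] is the set of words j with comm_equiv i j.       *)
(* Commutations preserve reduced words of w_0, see comm_equiv_reduced_w0.     *)
Inductive comm_equiv n (w : word n) : word n -> Prop :=
| comm_refl : comm_equiv w w
| comm_swap u v i j : far i j ->
    comm_equiv w (u ++ [:: i, j & v]) -> comm_equiv w (u ++ [:: j, i & v]).

Definition sink n (i : index n) (w : word n) : Prop :=
  exists u, comm_equiv w (i :: u).

Definition source n (i : index n) (w : word n) : Prop :=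
  exists u, comm_equiv w (rcons u i).

(* [w] r_i = [w'] *)
Definition right_functor n (i : index n) (w w' : word n) : Prop :=
  (exists u, comm_equiv w (i :: u) /\ comm_equiv (rcons u (dual i)) w')
  \/ (~ sink i w /\ comm_equiv w w').

(* r_i [w] = [w'] *)
Definition left_functor n (i : index n) (w w' : word n) : Prop :=
  (exists u, comm_equiv w (rcons u i) /\ comm_equiv (dual i :: u) w')
  \/ (~ source i w /\ comm_equiv w w').

Definition twisted_word n : word n :=
  flatten [seq [seq iter k (@dual n) (inord i) | i <- iota 0 n.+1]
          | k <- iota 0 n.*2.+1].

(* A class is given by any of its words.                                      *)
Inductive twisted_adapted n : word n -> Prop :=
| tw_base w : comm_equiv (twisted_word n) w -> twisted_adapted w
| tw_right i w w' :
    twisted_adapted w -> right_functor i w w' -> twisted_adapted w'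
| tw_left i w w' :
    twisted_adapted w -> left_functor i w w' -> twisted_adapted w'.

(* The position k is counted from 0; only k < size j is meaningful.           *)
Definition beta n (j : word n) (k : nat) : lattice n :=
  act (take k j) (alpha (nth ord0 j k)).

Notation msequence n := {ffun posroot n -> nat}.

(* The value of m at a root given as a vector; the default value is never     *)
(* used at beta j k when j is a reduced word.                                 *)
Definition value n (m : msequence n) (v : lattice n) : nat :=
  if [pick g : posroot n | root g == v] is Some g then m g else 0%N.

Definition wt n (m : msequence n) : lattice n := \sum_g root g *+ m g.

Definition single n (g : posroot n) : msequence n :=
  [ffun d => (d == g) : nat].

Definition pair_seq n (a b : posroot n) : msequence n :=
  [ffun d => (d == a) + (d == b)]%N.

Definition blt n (j : word n) (m' m : msequence n) : Prop :=
  exists k s : nat,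
    [/\ (k <= s < size j)%N,
        forall t, (t < size j)%N -> (t < k)%N || (s < t)%N ->
          value m' (beta j t) = value m (beta j t),
        (value m' (beta j k) < value m (beta j k))%N
      & (value m' (beta j s) < value m (beta j s))%N].

Definition prec n (i0 : word n) (m' m : msequence n) : Prop :=
  forall j, comm_equiv i0 j -> blt j m' m.

Definition preceq n (i0 : word n) (m' m : msequence n) : Prop :=
  m' = m \/ prec i0 m' m.

Definition simple_pair n (i0 : word n) (a b : posroot n) : Prop :=
  ~ exists m, prec i0 m (pair_seq a b) /\ wt m = wt (pair_seq a b).

Definition simple_seq n (i0 : word n) (m : msequence n) : Prop :=
  (exists g, forall d, (m d != 0%N) = (d == g))
  \/ (forall a b, a != b -> m a != 0%N -> m b != 0%N -> simple_pair i0 a b).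

(* c 0 < ... < c (k - 1) = m is a chain of k non-simple sequences of the same *)
(* weight.                                                                    *)
Definition nonsimple_chain n (i0 : word n) (m : msequence n) (k : nat)
    (c : nat -> msequence n) : Prop :=
  [/\ (0 < k)%N, c k.-1 = m,
      forall a, (a < k)%N -> ~ simple_seq i0 (c a) /\ wt (c a) = wt m
    & forall a, (a.+1 < k)%N -> prec i0 (c a) (c a.+1)].

(* is_gdist i0 m d means gdist m = d; it asserts that the maximum exists.     *)
Definition is_gdist n (i0 : word n) (m : msequence n) (d : nat) : Prop :=
  (simple_seq i0 m /\ d = 0%N)
  \/ [/\ ~ simple_seq i0 m, exists c, nonsimple_chain i0 m d c
       & forall k c, nonsimple_chain i0 m k c -> (k <= d)%N].

Definition pair_above n (i0 : word n) (g a b : posroot n) : Prop :=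
  [/\ a != b, prec i0 (single g) (pair_seq a b) & wt (pair_seq a b) = root g].

(* is_rds i0 g d means rds g = d; it asserts that the maximum exists.         *)
Definition is_rds n (i0 : word n) (g : posroot n) (d : nat) : Prop :=
  (exists a b, pair_above i0 g a b /\ is_gdist i0 (pair_seq a b) d)
  /\ (forall a b, pair_above i0 g a b ->
        exists2 e, is_gdist i0 (pair_seq a b) e & (e <= d)%N).

Definition is_soc n (i0 : word n) (m s : msequence n) : Prop :=
  [/\ simple_seq i0 s, wt s = wt m & preceq i0 s m].

Lemma root_coord n (g : posroot n) i : root g 0 i = (coef g i)%:Z.
Proof.
rewrite /root summxE (bigD1 i) //= mulmxnE mxE !eqxx.
rewrite big1 ?addr0 ?natz // => k ki.
by rewrite mulmxnE mxE eqxx eq_sym (negPf ki) mul0rn.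
Qed.

Lemma root_inj n : injective (@root n).
Proof.
move=> [[a b] /= ab] [[c d] /= cd] /rowP E.
have E' (i : index n) : ((a <= i <= b) = (c <= i <= d))%N.
  have := E i; rewrite !root_coord /coef /= => -[].
  by do 2 case: (_ <= _ <= _)%N.
have [ac bd] : a = c :> nat /\ b = d :> nat.
  move: (E' a) (E' b) (E' c) (E' d); rewrite !leqnn ab cd; lia.
by apply/val_inj => /=; congr (_, _); apply/val_inj.
Qed.

Lemma value_root n (m : msequence n) g : value m (root g) = m g.
Proof.
rewrite /value; case: pickP => [d /eqP/root_inj -> //|/(_ g)].
by rewrite eqxx.
Qed.

Lemma refl_coord n (i j : index n) (v : lattice n) : i != j ->
  refl i v 0 j = v 0 j.
Proof.
by move=> ij; rewrite !mxE eqxx eq_sym (negPf ij) mulr0 subr0.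
Qed.

Lemma refl_comm n (i j : index n) (v : lattice n) : far i j ->
  refl i (refl j v) = refl j (refl i v).
Proof.
have pairing (k l : index n) u : far k l ->
    \sum_h refl l u 0 h * cartan k h = \sum_h u 0 h * cartan k h.
  move=> kl; apply: eq_bigr => h _.
  have [->|lh] := eqVneq h l; last by rewrite refl_coord // eq_sym.
  have kNl: k != l by apply: contraTneq kl => ->; rewrite /far; lia.
  by rewrite /cartan (negPf kNl) kl !mulr0.
move=> ij; have ji : far j i by move: ij; rewrite /far orbC.
rewrite {1}/refl pairing // [RHS]/refl pairing // /refl.
by rewrite addrAC.
Qed.

Lemma comm_equiv_act n (w w' : word n) : comm_equiv w w' ->
  act w' =1 act w /\ size w' = size w.
Proof.
elim=> [|u v i j ij _ [actE sizeE]] //; split=> [x|].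
  by rewrite -actE /act !foldr_cat /= (refl_comm _ ij).
by rewrite -sizeE !size_cat.
Qed.

Lemma comm_equiv_reduced_w0 n (w w' : word n) :
  comm_equiv w w' -> reduced_w0 w -> reduced_w0 w'.
Proof.
case/comm_equiv_act=> actE sizeE [red longest].
split=> j; rewrite sizeE; last exact: longest.
by move=> actj; apply: red => x; rewrite actj actE.
Qed.

Lemma is_gdist_uniq n (i0 : word n) m d e :
  is_gdist i0 m d -> is_gdist i0 m e -> d = e.
Proof.
case=> [[sm ->]|[nsm [c Hc] maxd]] [[sm' ->]|[nsm' [c' Hc'] maxe]] //.
by apply/eqP; rewrite eqn_leq (maxe _ _ Hc) (maxd _ _ Hc').
Qed.

(* Main.v *)
From mathcomp Require Import all_boot all_order all_algebra zify boolp.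
Require Import Defs.

(* A reduced word of w_0 is a sweep of a pseudo-line arrangement with 2n+2 lines,
   dually of a configuration of 2n+2 points.  For a twisted adapted class the
   points are the vertices of a regular (2n+1)-gon and its center, and a reflection
   functor only rotates the direction of the sweep.  Hence every root gets two
   coordinates (the cyclic positions of the two ends of its chord, the center
   counting as the point opposite to the vertex), and the convex order of the class
   implies the componentwise order of the coordinates, because the class contains
   the words sorted lexicographically by either coordinate.

   A sequence strictly below a pair (e_a - e_b, e_c - e_d) of the same weight is a
   flow from {a, c} to {b, d} carried by the open interval between the two roots.
   The interval is closed under composition and does not contain the two roots, so
   the flow goes from a to d and from c to b.  This gives the socle.  The
   coordinates show that the flow can make a stop only at the center, and at most
   one of its two paths can make it.  So there is at most one non-simple sequence
   below the pair, and the distance is at most 2.  If the pair has weight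
   gamma = e_a - e_d and the distance is 2, the path from a to d stops at the center,
   whose label is n+1 or n+2.  The simple root alpha_(n+1) is the first or the last
   root through the center, so it is not one of the two steps, and gamma contains
   both alpha_n and alpha_(n+2). *)

Set Implicit Arguments.
Unset Strict Implicit.
Unset Printing Implicit Defensive.

(** * Height functions *)

Section Heights.

Import Order.TTheory GRing.Theory Num.Theory.
Local Open Scope ring_scope.

Variable n : nat.
Implicit Types (xi : nat -> int) (i k p : nat).

(* A root is recorded by the residue i of its letter and a time; [xi i] is the
   time of the next letter i.  Residues are numbered from 0, so the fixed point
   of the duality is i = n.  The two lines crossed there have the coordinates
   [xi i - width i] and [xi i + width i], twice the cyclic positions of the two
   vertices; one turn of the polygon is [period]. *)
Definition period : int := 4 * (n.*2.+1)%:Z.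

Definition width i : int :=
  if (i < n)%N then 2 * i.+1%:Z else if i == n then (n.*2.+1)%:Z else 2 * i%:Z.

Definition jump i : int := if i == n then 2 else 4.

Definition step xi i : nat -> int := fun k => if k == i then xi k + jump i else xi k.

(** The sink condition in terms of heights: the next letter i is due before the next letters of its
    neighbours. *)
Definition ready xi i : Prop :=
  ((0 < i)%N -> xi i < xi i.-1) /\ ((i < n.*2)%N -> xi i < xi i.+1).

Definition sw i p : nat :=
  if p == i then i.+1 else if p == i.+1 then i else p.

(* The residue n is crossed twice as often as the others, and between two of its
   letters exactly one of the residues n - 1 and n + 1 occurs, alternately. *)
Definition height xi : Prop :=
  [/\ forall i, (i < n.*2)%N -> i != n -> i.+1 != n ->
        xi i.+1 = xi i + 2 \/ xi i.+1 = xi i - 2,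
      forall i, (i <= n.*2)%N -> i != n -> ((xi i - width i) %% 4)%Z = 0
    & [\/ xi n.-1 = xi n + 3 /\ xi n.+1 = xi n + 1,
          xi n.-1 = xi n + 1 /\ xi n.+1 = xi n - 1,
          xi n.-1 = xi n + 1 /\ xi n.+1 = xi n + 3
        | xi n.-1 = xi n - 1 /\ xi n.+1 = xi n + 1]].

(* The coordinate of the line at position p (between the residues p - 1 and p),
   read off from its next crossing. *)
Definition line xi p : int :=
  if p == 0%N then xi 0%N - width 0
  else if p == n.*2.+1 then xi n.*2 + width n.*2
  else if xi p < xi p.-1 then xi p - width p else xi p.-1 + width p.-1.

(* The vertices of the polygon have coordinates divisible by 4; all the other
   coordinates belong to the center. *)
Definition cls (x : int) : int := if (x %% 4)%Z == 0 then (x %% period)%Z else -1.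

Lemma cls_shift x : cls (x + period) = cls x.
Proof.
rewrite /cls modzDr; congr (if _ == _ then _ else _).
by rewrite /period; lia.
Qed.

Lemma cls_odd x y : (x %% 4)%Z != 0 -> (y %% 4)%Z != 0 -> cls x = cls y.
Proof. by rewrite /cls => /negPf-> /negPf->. Qed.

Lemma cls_eq x y : cls x = cls y ->
  [/\ (x %% 4)%Z != 0 & (y %% 4)%Z != 0] \/
  [/\ (x %% 4)%Z = 0, (y %% 4)%Z = 0 & exists k : int, x = y + k * period].
Proof.
have pos : 0 < period by rewrite /period; lia.
rewrite /cls; do 2 case: eqP => ?; move=> E; try by left.
- right; split=> //; exists ((x %/ period)%Z - (y %/ period)%Z).
  by rewrite {1}(divz_eq x period) {1}(divz_eq y period) E; lia.
- by have := modz_ge0 x (lt0r_neq0 pos); lia.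
- by have := modz_ge0 y (lt0r_neq0 pos); lia.
Qed.

Lemma width_dual i : (i <= n.*2)%N -> width (n.*2 - i) = 2 * (n.*2.+1)%:Z - width i.
Proof. by rewrite /width => ?; repeat case: ifP; lia. Qed.

Lemma sw_inv k : involutive (sw k).
Proof. by move=> p; rewrite /sw; repeat case: ifP; lia. Qed.

Lemma sw_le i p : (i <= n.*2)%N -> (p <= n.*2.+1)%N -> (sw i p <= n.*2.+1)%N.
Proof. by rewrite /sw; repeat case: ifP; lia. Qed.

Hypothesis n_gt0 : (0 < n)%N.

(** The four patterns around the residue n form a cycle 1, 2, 3, 4, 1, along which the letters n, n
    + 1, n, n - 1 are read in turn; in each pattern the other two of these residues are not
    ready. *)
Lemma height_step xi i : (i <= n.*2)%N -> height xi -> ready xi i -> height (step xi i).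
Proof.
move=> i_le [G1 G2 G3] [r1 r2]; split.
- move=> k k1 k2 k3; have := G1 k k1 k2 k3; rewrite /step /jump.
  case: (eqVneq k i) => [ki|_].
    move: (r2); rewrite -ki => /(_ k1); have -> : (k.+1 == k) = false by lia.
    by rewrite (negPf k2); lia.
  case: (eqVneq k.+1 i) => [ki|_] //.
  by move: r1; rewrite -ki /=; repeat case: ifP; lia.
- move=> k k1 k2; have := G2 k k1 k2; rewrite /step /jump.
  by repeat case: ifP; lia.
- have [e1 e2 e3 e4] : [/\ (n.-1 == n) = false, (n.+1 == n) = false,
      n.-1.+1 = n & (n < n.*2)%N] by split; lia.
  rewrite /step /jump; have [ni|ni] := eqVneq i n.
    subst i; rewrite ?eqxx e1 e2.
    by case: G3 (r1 n_gt0) (r2 e4) => -[-> ->]; [constructor 2|..|constructor 4| ]; lia.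
  have e5 : (n.+1 == n.-1) = false by lia.
  have [ni1|ni1] := eqVneq i n.-1.
    subst i; rewrite e5.
    by move: r2; rewrite e3; case: G3 => -[-> ->]; [..|constructor 1]; lia.
  have [ni2|ni2] := eqVneq i n.+1.
    subst i.
    by move: r1 => /= r1; case: G3 (r1 isT) => -[-> ->]; [|constructor 3|..]; lia.
  exact: G3.
Qed.

Lemma line_left xi i : (i <= n.*2)%N -> ready xi i -> line xi i = xi i - width i.
Proof.
rewrite /line => i_le [r1 _]; case: (eqVneq i 0%N) => [-> //|i0].
by rewrite (_ : (i == _) = false) ?r1 ?lt0n //; lia.
Qed.

Lemma line_right xi i : (i <= n.*2)%N -> ready xi i -> line xi i.+1 = xi i + width i.
Proof.
rewrite /line /= eqSS => i_le [_ r2]; case: (eqVneq i n.*2) => [-> //|i2].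
by rewrite ltNge ltW ?r2 //; lia.
Qed.

(** A coordinate travels unchanged with its line, with two exceptions that [cls] forgets: a line
    arriving at the last position gains one [period], and the center may jump to another value that
    is not divisible by 4. *)
Lemma line_step xi i p : (i <= n.*2)%N -> (p <= n.*2.+1)%N ->
  height xi -> ready xi i -> cls (line (step xi i) p) = cls (line xi (sw i p)).
Proof.
move=> i_le p_le [G1 G2 G3] rdy; have [r1 r2] := rdy.
have ji : step xi i i = xi i + jump i by rewrite /step eqxx.
have jn k : k != i -> step xi i k = xi k by rewrite /step => /negPf->.
have G2n : ((xi n.-1 - 2 * n%:Z) %% 4)%Z = 0.
  have -> : 2 * n%:Z = width n.-1 by rewrite /width; repeat case: ifP; lia.
  by apply: G2; lia.
rewrite /sw; have [->|pi] := eqVneq p i.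
  rewrite line_right // /line (_ : (i == n.*2.+1) = false); last by lia.
  have [i0|i0] := eqVneq i 0%N.
    by rewrite -i0 ji /jump /width i0 (_ : (0 == n)%N = false) ?n_gt0; try congr cls; lia.
  rewrite ji jn; last by lia.
  have [ni|ni] := eqVneq i n.
    rewrite /jump ni eqxx; case: G3 => -[E E']; rewrite E.
    - rewrite ifT; last by lia.
      by apply: cls_odd; rewrite /width ltnn eqxx; lia.
    - by rewrite ifF; [congr cls; rewrite /width ltnn eqxx; repeat case: ifP; lia|lia].
    - by rewrite ifF; [congr cls; rewrite /width ltnn eqxx; repeat case: ifP; lia|lia].
    - by have := r1; rewrite ni; lia.
  rewrite /jump (negPf ni).
  have [ni1|ni1] := eqVneq i n.+1.
    have E : xi n = xi i + 1 by move: r1; rewrite ni1 /=; case: G3 => -[E E']; lia.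
    rewrite ni1 /= in E *; rewrite E ifF; last by lia.
    by congr cls; rewrite /width; repeat case: ifP; lia.
  have E : xi i.-1 = xi i + 2.
    have := G1 i.-1; rewrite prednK ?lt0n // => /(_ _ _ _) G.
    by have := r1; have : xi i = xi i.-1 + 2 \/ xi i = xi i.-1 - 2; [apply: G|]; lia.
  rewrite E ifF; last by lia.
  by congr cls; rewrite /width; repeat case: ifP; lia.
have [->|pi1] := eqVneq p i.+1.
  rewrite (line_left i_le rdy) /line (_ : (i.+1 == n.*2.+1) = (i == n.*2)) //=.
  have [i2|i2] := eqVneq i n.*2.
    rewrite -i2 ji /jump (_ : (i == n) = false); last by lia.
    rewrite -(cls_shift (_ - _)); congr cls.
    by rewrite /width /period; repeat case: ifP; lia.
  rewrite ji jn; last by lia.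
  have lt_i : (i < n.*2)%N by lia.
  have := r2 lt_i => {}r2.
  have [ni|ni] := eqVneq i n.
    rewrite /jump ni eqxx; case: G3 => -[E E']; rewrite E'.
    - by rewrite ifT; [congr cls; rewrite /width ltnn eqxx; repeat case: ifP; lia|lia].
    - by have := r2; rewrite ni; lia.
    - rewrite ifF; last by lia.
      by apply: cls_odd; rewrite /width ltnn eqxx; lia.
    - by rewrite ifT; [congr cls; rewrite /width ltnn eqxx; repeat case: ifP; lia|lia].
  rewrite /jump (negPf ni).
  have [ni1|ni1] := eqVneq i.+1 n.
    have in1 : i = n.-1 by lia.
    have E : xi n = xi i + 1.
      by move: r2; rewrite ni1 in1; case: G3 => -[E E']; lia.
    rewrite ni1 E ifT; last by lia.
    by congr cls; rewrite /width; repeat case: ifP; lia.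
  have E : xi i.+1 = xi i + 2 by have := G1 i lt_i ni ni1; lia.
  rewrite E ifT; last by lia.
  by congr cls; rewrite /width; repeat case: ifP; lia.
rewrite /line; case: eqVneq => [p0|p0]; first by (rewrite jn; [|lia]).
case: eqVneq => [p2|p2]; first by (rewrite jn; [|lia]).
by rewrite !jn; lia.
Qed.

End Heights.

(** * The invariant of twisted adapted words *)

Section Runs.

Import Order.TTheory GRing.Theory Num.Theory.
Local Open Scope ring_scope.

Variable n : nat.
Hypothesis n_gt0 : (0 < n)%N.
Implicit Types (xi : nat -> int) (p : nat) (i : index n) (w : word n).

Lemma height_neq xi k : height n xi -> (k < n.*2)%N -> xi k.+1 != xi k.
Proof.
move=> [G1 _ G3] lt_k.
have [kn|kn] := eqVneq k n; first by rewrite kn; case: G3 => -[E E']; lia.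
have [kn1|kn1] := eqVneq k.+1 n.
  by rewrite kn1 (_ : k = n.-1); last lia; case: G3 => -[E E']; lia.
by have := G1 k lt_k kn kn1; lia.
Qed.

Fixpoint run xi w : Prop :=
  if w is i :: u then ready n xi i /\ run (step n xi i) u else True.

Fixpoint after xi w : nat -> int := if w is i :: u then after (step n xi i) u else xi.

Definition agree xi xi' := forall k, (k <= n.*2)%N -> xi k = xi' k.

Definition dual_height (c : int) xi : nat -> int := fun k => xi (n.*2 - k)%N + c.

Lemma agree_refl xi : agree xi xi. Proof. by []. Qed.

Lemma agree_sym xi xi' : agree xi xi' -> agree xi' xi.
Proof. by move=> E k /E. Qed.

Lemma agree_trans xi2 xi1 xi3 : agree xi1 xi2 -> agree xi2 xi3 -> agree xi1 xi3.
Proof. by move=> E E' k k_le; rewrite E ?E'. Qed.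

Lemma step_agree xi xi' k : agree xi xi' -> agree (step n xi k) (step n xi' k).
Proof. by move=> E l l_le; rewrite /step E. Qed.

Lemma after_agree xi xi' w : agree xi xi' -> agree (after xi w) (after xi' w).
Proof. by elim: w xi xi' => [|i w IH] xi xi' //= E; apply: IH; exact: step_agree. Qed.

Lemma dual_agree c xi xi' : agree xi xi' -> agree (dual_height c xi) (dual_height c xi').
Proof. by move=> E k k_le; rewrite /dual_height E //; lia. Qed.

Lemma ready_agree xi xi' k : (k <= n.*2)%N -> agree xi xi' -> ready n xi k -> ready n xi' k.
Proof.
move=> k_le E [r1 r2]; split=> H; rewrite -!E; [exact: r1|lia..|exact: r2|lia|lia].
Qed.

Lemma run_agree xi xi' w : agree xi xi' -> run xi w -> run xi' w.
Proof.
elim: w xi xi' => [|i w IH] xi xi' //= E [r1 r2]; split.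
  by apply: ready_agree r1 => //; exact: (ltn_ord i).
by apply: IH r2; exact: step_agree.
Qed.

Lemma line_agree xi xi' p : (p <= n.*2.+1)%N -> agree xi xi' -> line n xi p = line n xi' p.
Proof.
by move=> p_le E; rewrite /line; case: eqP => p0; [|case: eqP => p1]; rewrite !E //; lia.
Qed.

Lemma run_cat xi u v : run xi (u ++ v) <-> run xi u /\ run (after xi u) v.
Proof.
elim: u xi => [|i u IH] xi /=; first by split=> [|[]].
by rewrite IH; tauto.
Qed.

Lemma after_cat xi u v : after xi (u ++ v) = after (after xi u) v.
Proof. by elim: u xi => /=. Qed.

Lemma height_run xi w : height n xi -> run xi w -> height n (after xi w).
Proof.
elim: w xi => [|i w IH] xi //= hx [r1 r2]; apply: IH r2.
by apply: height_step r1 => //; exact: (ltn_ord i).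
Qed.

Lemma step_comm xi (k l : nat) : k != l ->
  step n (step n xi k) l =1 step n (step n xi l) k.
Proof.
move=> kl h; rewrite /step; case: (h =P l) => [->|_] //.
by rewrite eq_sym (negPf kl).
Qed.

Lemma ready_step_far xi i k : far i k -> ready n (step n xi i) k <-> ready n xi k.
Proof.
rewrite /far => ik; rewrite /ready /step.
rewrite (_ : (k == i :> nat) = false); last by lia.
rewrite (_ : (k.+1 == i) = false); last by lia.
case: (eqVneq (k : nat) 0%N) => [->|k0]; first by rewrite ltnn; split=> -[].
by rewrite (_ : (k.-1 == i) = false); last by lia.
Qed.

Lemma run_swap xi i k v : far i k -> run xi [:: i, k & v] -> run xi [:: k, i & v].
Proof.
move=> ik /= [r1 [r2 r3]].
have ki : far k i by move: ik; rewrite /far orbC.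
split; first exact/(ready_step_far _ ik).
split; first exact/(ready_step_far _ ki).
apply: run_agree r3 => h _; apply: step_comm.
by move: ik; rewrite /far; lia.
Qed.

Lemma after_swap xi i k v : far i k ->
  agree (after xi [:: i, k & v]) (after xi [:: k, i & v]).
Proof.
move=> ik /=; apply: after_agree => h _; apply: step_comm.
by move: ik; rewrite /far; lia.
Qed.

Lemma run_comm xi w w' : comm_equiv w w' -> run xi w -> run xi w'.
Proof.
elim=> // u v i k ik _ IH /IH; rewrite !run_cat => -[r1 r2].
by split=> //; exact: run_swap ik r2.
Qed.

(** Duality exchanges the patterns 1 and 3, and the patterns 2 and 4. The shift is 2 modulo 4
    because the widths of a residue and of its dual, even numbers away from n, add up to 2 (2n +
    1). *)
Lemma height_dual c xi : (c %% 4)%Z = 2 -> height n xi -> height n (dual_height c xi).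
Proof.
move=> c4 [G1 G2 G3]; rewrite /dual_height; split.
- move=> k k1 k2 k3; have := G1 (n.*2 - k.+1)%N.
  by rewrite (_ : (n.*2 - k.+1).+1 = n.*2 - k)%N; [move=> H|]; lia.
- move=> k k1 k2; have := G2 (n.*2 - k)%N; rewrite width_dual // => H.
  have : (width n k %% 2)%Z = 0 by rewrite /width (negPf k2); case: ifP; lia.
  by lia.
- rewrite (_ : n.*2 - n.-1 = n.+1)%N; last by lia.
  rewrite (_ : n.*2 - n.+1 = n.-1)%N; last by lia.
  rewrite (_ : n.*2 - n = n)%N; last by lia.
  by case: G3 => -[-> ->]; [constructor 3|constructor 4|constructor 1|constructor 2]; lia.
Qed.

Lemma ready_dual c xi k : (k <= n.*2)%N ->
  ready n xi k -> ready n (dual_height c xi) (n.*2 - k)%N.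
Proof.
rewrite /ready /dual_height => k_le [r1 r2]; split=> k0.
  rewrite (_ : n.*2 - (n.*2 - k) = k)%N; last by lia.
  rewrite (_ : n.*2 - (n.*2 - k).-1 = k.+1)%N; last by lia.
  by have := r2; lia.
rewrite (_ : n.*2 - (n.*2 - k) = k)%N; last by lia.
rewrite (_ : n.*2 - (n.*2 - k).+1 = k.-1)%N; last by lia.
by have := r1; lia.
Qed.

Lemma step_dual c xi k : (k <= n.*2)%N ->
  agree (step n (dual_height c xi) (n.*2 - k)%N) (dual_height c (step n xi k)).
Proof.
move=> k_le l l_le; rewrite /step /dual_height /jump.
rewrite (_ : (l == n.*2 - k)%N = (n.*2 - l == k)%N); last by lia.
by case: ifP => // E; rewrite (_ : (n.*2 - k == n)%N = (k == n)); lia.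
Qed.

(** Duality exchanges the left and the right line of a crossing. As dual widths add up to half a
    [period], the time shift by the same amount restores every coordinate up to a multiple of
    [period]. *)
Lemma line_dual xi p : (p <= n.*2.+1)%N -> height n xi ->
  cls n (line n (dual_height (2 * (n.*2.+1)%:Z) xi) p) = cls n (line n xi (n.*2.+1 - p)).
Proof.
move=> p_le hx; rewrite /line /dual_height.
have [->|p0] := eqVneq p 0%N.
  rewrite subn0 subn0 eqxx /= (_ : (width n 0 = 2 * (n.*2.+1)%:Z - width n n.*2)).
    by congr cls; lia.
  by rewrite -width_dual // subnn.
have [->|p1] := eqVneq p n.*2.+1.
  rewrite subnn subnn -(cls_shift n (_ - _)); congr cls.
  by have := @width_dual n 0%N isT; rewrite subn0 /period; lia.
rewrite (_ : (n.*2.+1 - p == 0)%N = false); last by lia.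
rewrite (_ : (n.*2.+1 - p == n.*2.+1)%N = false); last by lia.
rewrite (_ : (n.*2.+1 - p).-1 = n.*2 - p)%N; last by lia.
rewrite (_ : (n.*2 - p.-1) = n.*2.+1 - p)%N; last by lia.
have neq : xi (n.*2.+1 - p)%N != xi (n.*2 - p)%N.
  have := @height_neq xi (n.*2 - p)%N hx.
  rewrite (_ : (n.*2 - p).+1 = n.*2.+1 - p)%N; last by lia.
  by apply; lia.
case: ifP => lt1.
  by rewrite ifF ?width_dual; [congr cls|..]; lia.
rewrite ifT; last by lia.
rewrite -(cls_shift n (_ - _)); congr cls.
rewrite (_ : n.*2.+1 - p = n.*2 - p.-1)%N ?width_dual /period; lia.
Qed.

Definition separated xi := forall p q, (p <= n.*2.+1)%N -> (q <= n.*2.+1)%N ->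
  cls n (line n xi p) = cls n (line n xi q) -> p = q.

Lemma separated_step xi i : height n xi -> ready n xi i ->
  separated xi <-> separated (step n xi i).
Proof.
have i_le : (i <= n.*2)%N := ltn_ord i.
move=> hx rx; split=> sx p q p_le q_le E.
  apply: (can_inj (@sw_inv i)); apply: sx; rewrite ?sw_le //.
  by rewrite -!line_step //; exact: (ltn_ord i).
apply: (can_inj (@sw_inv i)); apply: sx; rewrite ?sw_le //.
by rewrite !line_step ?sw_le ?sw_inv //; exact: (ltn_ord i).
Qed.

(** This is half of [period]: the time in which one reduced word of w_0 is read. *)
Definition full_turn : int := 2 * (n.*2.+1)%:Z.

(* Reading w turns the configuration by a half turn, which exchanges i and its
   dual; this form of the invariant is stable under the reflection functors. *)
Definition sweep xi w : Prop :=
  [/\ height n xi, separated xi, run xi w,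
      agree (after xi w) (dual_height full_turn xi)
    & size w = (n.+1 * n.*2.+1)%N].

Lemma sweep_comm xi w w' : comm_equiv w w' -> sweep xi w -> sweep xi w'.
Proof.
elim=> // u v i k ik _ IH /IH[hx sx rx].
rewrite after_cat !size_cat => ag sz; split=> //.
- by apply: run_comm rx; exact: comm_swap ik (comm_refl _).
- by rewrite after_cat; apply: agree_trans ag; apply/agree_sym/after_swap.
- by rewrite size_cat.
Qed.

(** The final heights are dual to the initial ones, so a letter that is ready at the start has its
    dual ready at the end, and after both steps the two ends are dual again. *)
Lemma sweep_right xi i u : sweep xi (i :: u) -> sweep (step n xi i) (rcons u (dual i)).
Proof.
have i_le : (i <= n.*2)%N := ltn_ord i.
have vd : (dual i : nat) = (n.*2 - i)%N by rewrite /= subSS.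
case=> hx sx /= [r1 r2] ag sz; split.
- by apply: height_step.
- exact/(separated_step hx r1).
- rewrite -cats1 run_cat; split=> //; split=> //.
  apply: ready_agree (agree_sym ag) _; first exact: (ltn_ord (dual i)).
  by rewrite vd; exact: ready_dual.
- rewrite -cats1 after_cat; apply: agree_trans (step_agree _ ag) _.
  by rewrite vd; exact: step_dual.
- by rewrite size_rcons.
Qed.

Lemma sweep_left xi i u : sweep xi (rcons u i) -> exists xi', sweep xi' (dual i :: u).
Proof.
have i_le : (i <= n.*2)%N := ltn_ord i.
have vd : (dual i : nat) = (n.*2 - i)%N by rewrite /= subSS.
case=> hx sx; rewrite -cats1 run_cat after_cat size_cat /= => -[r1 [r2 _]] ag sz.
(* The new start is the dual, half a [period] earlier, of the heights just before the last letter.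
   There [dual i] is ready, and reading it leads back to [xi]. *)
set e := after xi u in r2 ag; pose xi' := dual_height (- full_turn) e.
have he : height n e by exact: height_run.
have hx' : height n xi' by apply: height_dual => //; rewrite /full_turn; lia.
have rx' : ready n xi' (dual i) by rewrite vd; exact: ready_dual.
have sx' : agree (step n xi' (dual i)) xi.
  rewrite vd; apply: agree_trans (step_dual _ _ i_le) _.
  apply: agree_trans (dual_agree _ ag) _ => k k_le.
  by rewrite /dual_height subKn // addrK.
exists xi'; split=> //.
- apply/(separated_step hx' rx') => p q p_le q_le.
  by rewrite !(line_agree _ sx') //; exact: sx.
- by split=> //; exact: run_agree (agree_sym sx') r1.
- apply: agree_trans (after_agree _ sx') _ => k k_le.
  by rewrite /dual_height /= /xi' /dual_height subKn // subrK.
- by rewrite /= -sz addn1.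
Qed.

(* In the twisted word the first n heights rise at the even rounds only, the
   last n heights at the odd ones. *)
Definition round_height k r : int :=
  if (r < n)%N then 2 * r.+1%:Z + 4 * (uphalf k)%:Z
  else if r == n then (n.*2.+1)%:Z + 2 * k%:Z
  else 4 * n.+1%:Z - 2 * r%:Z + 4 * (k./2)%:Z.

(** The heights in the middle of round k, with j letters read. An odd round reads the dual letters,
    in the order 2n, 2n - 1, ..., n. *)
Definition inner_height k j r : int :=
  round_height k r + (if ((if odd k then n.*2 - r else r) < j)%N then jump n r else 0).

Lemma iter_dual k i : (iter k (@dual n) i : nat) = if odd k then (n.*2 - i)%N else i.
Proof.
elim: k => //= k ->; rewrite subSS; case: (odd k) => //=.
by rewrite subKn //; exact: (ltn_ord i).
Qed.

Definition round k (l : seq nat) : word n := [seq iter k (@dual n) (inord r) | r <- l].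

Lemma run_round k m j xi : (j + m <= n.+1)%N -> agree xi (inner_height k j) ->
  run xi (round k (iota j m)) /\
  agree (after xi (round k (iota j m))) (inner_height k (j + m)).
Proof.
elim: m j xi => [|m IH] j xi le_jm ag /=; first by rewrite addn0.
pose r := if odd k then (n.*2 - j)%N else j.
have -> : iter k (@dual n) (inord j) = r :> nat.
  by rewrite iter_dual inordK //; lia.
have [| |r1 r2] := IH j.+1 (step n xi r); first by lia.
  apply: agree_trans (step_agree _ ag) _ => l l_le.
  rewrite /step /inner_height; case: (l =P r) => [->|]; rewrite /r.
    by case: (odd k); repeat case: ifP; lia.
  by case: (odd k) => lr; repeat case: ifP; lia.
rewrite addSnnS in r2; split=> //; split=> //.
apply: (ready_agree _ (agree_sym ag)); first by rewrite /r; case: (odd k); lia.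
have := odd_double_half k; rewrite /ready /inner_height /round_height uphalf_half /jump /r.
by case: (odd k) => /= E; split=> H; repeat case: ifP; lia.
Qed.

Lemma run_rounds m k xi : agree xi (round_height k) ->
  [/\ run xi (flatten [seq round h (iota 0 n.+1) | h <- iota k m]),
      agree (after xi (flatten [seq round h (iota 0 n.+1) | h <- iota k m]))
            (round_height (k + m))
    & size (flatten [seq round h (iota 0 n.+1) | h <- iota k m]) = (m * n.+1)%N].
Proof.
elim: m k xi => [|m IH] k xi ag; first by rewrite addn0.
have -> : flatten [seq round h (iota 0 n.+1) | h <- iota k m.+1] =
  round k (iota 0 n.+1) ++ flatten [seq round h (iota 0 n.+1) | h <- iota k.+1 m] by [].
have [|r1 r2] := @run_round k n.+1 0 xi (leqnn _).
  by move=> l l_le; rewrite ag // /inner_height ltn0 addr0.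
have [|s1 s2 s3] := IH k.+1 (after xi (round k (iota 0 n.+1))).
  apply: agree_trans r2 _ => l l_le.
  have := odd_double_half k; rewrite /inner_height /round_height /= uphalf_half /jump.
  by case: (odd k) => /= E; repeat case: ifP; lia.
split; first by rewrite run_cat.
  by rewrite after_cat -addSnnS.
by rewrite size_cat s3 size_map size_iota mulSn.
Qed.

Lemma sweep_base : sweep (round_height 0) (twisted_word n).
Proof.
have [r1 r2 r3] := @run_rounds n.*2.+1 0 (round_height 0) (@agree_refl _).
split=> //.
- split.
  + by move=> i i1 i2 i3; rewrite /round_height /=; repeat case: ifP; lia.
  + by move=> i i1 i2; rewrite /round_height /width /=; repeat case: ifP; lia.
  + by constructor 4; rewrite /round_height /=; repeat case: ifP; lia.
(* The positions 0, ..., n carry the vertices 0, 4, ..., 4n, the next one carries the center, and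
   the rest carry -4, ..., -4n, which are the remaining vertices modulo [period]. *)
- have lineE p : (p <= n.*2.+1)%N -> cls n (line n (round_height 0) p) =
      cls n (if (p <= n)%N then 4 * p%:Z else if p == n.+1 then 4 * n%:Z + 2
             else 4 * n.+1%:Z - 4 * p%:Z).
    move=> p_le; rewrite /line; case: eqP => [->|p0].
      by congr cls; rewrite /round_height /width n_gt0.
    case: eqP => [->|p1].
      rewrite -(cls_shift n (if _ then _ else _)); congr cls.
      by rewrite /round_height /width /period /=; repeat case: ifP; lia.
    by congr cls; rewrite /round_height /width /=; repeat case: ifP; lia.
  move=> p q p_le q_le; rewrite !lineE // => /cls_eq[].
    by repeat case: ifP; lia.
  case=> _ _ [k]; rewrite /period.
  have [->|[k1|k1]] : k = 0 \/ k >= 1 \/ k <= -1 by lia.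
  + by repeat case: ifP; lia.
  + by repeat case: ifP; nia.
  + by repeat case: ifP; nia.
- apply: agree_trans r2 _ => k k_le; rewrite /dual_height /round_height /full_turn /=.
  by repeat case: ifP; lia.
- by rewrite r3 mulnC.
Qed.

Lemma twisted_adapted_sweep w : twisted_adapted w -> exists xi, sweep xi w.
Proof.
elim=> [w0 E|i w0 w' _ [xi sx]|i w0 w' _ [xi sx]].
- by exists (round_height 0); exact: sweep_comm E sweep_base.
- case=> [[u [E1 E2]]|[_ E]]; last by exists xi; exact: sweep_comm sx.
  by exists (step n xi i); apply: sweep_comm E2 _; exact/sweep_right/(sweep_comm E1).
- case=> [[u [E1 E2]]|[_ E]]; last by exists xi; exact: sweep_comm sx.
  by have [xi' sx'] := sweep_left (sweep_comm E1 sx); exists xi'; exact: sweep_comm E2 sx'.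
Qed.

End Runs.

(** * Roots and crossings *)

Section Labels.

Import Order.TTheory GRing.Theory Num.Theory.
Local Open Scope ring_scope.

Variable n : nat.
Implicit Types (x y p q : nat) (i k : index n) (u v w : word n) (g h : posroot n)
  (xi : nat -> int) (r : nat -> nat).

(* The root alpha_x + ... + alpha_(y-1) is e_x - e_y, with source x and target y. *)
Definition src g : nat := (val g).1.
Definition tgt g : nat := (val g).2.+1.
Definition ends g := (src g, tgt g).

Lemma src_lt_tgt g : (src g < tgt g)%N.
Proof. by rewrite ltnS (valP g). Qed.

Lemma tgt_le g : (tgt g <= n.*2.+1)%N.
Proof. exact: (ltn_ord (val g).2). Qed.

Lemma ends_inj : injective ends.
Proof.
move=> [[a b] ab] [[c d] cd] [] /= E1 E2; apply/val_inj => /=.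
by congr (_, _); apply/val_inj.
Qed.

Lemma ends_ex x y : (x < y)%N -> (y <= n.*2.+1)%N -> exists2 g, src g = x & tgt g = y.
Proof.
move=> xy y_le.
have xP : (x < n.*2.+1)%N by lia.
have yP : (y.-1 < n.*2.+1)%N by lia.
have P : (Ordinal xP <= Ordinal yP)%N by rewrite /=; lia.
exists (exist (fun p : index n * index n => is_true (p.1 <= p.2)%N) (Ordinal xP, Ordinal yP) P).
  by [].
by rewrite /tgt /= prednK //; lia.
Qed.

Lemma card_posroot : #|{: posroot n}| = (n.+1 * n.*2.+1)%N.
Proof.
rewrite card_sig -sum1_card /=.
rewrite (eq_bigl (fun p : index n * index n => true && (p.1 <= p.2)%N)) //.
rewrite -(pair_big_dep xpredT (fun a b : index n => (a <= b)%N) (fun _ _ => 1%N)) /=.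
rewrite (exchange_big_dep xpredT) //=.
transitivity (\sum_(b < n.*2.+1) b.+1)%N.
  apply: eq_bigr => b _.
  by rewrite -(big_ord_widen _ (fun _ => 1%N) (ltn_ord b)) sum_nat_const card_ord muln1.
have gauss m : ((\sum_(b < m) b.+1).*2 = m * m.+1)%N.
  by elim: m => [|m IH]; rewrite ?big_ord0 // big_ord_recr /= doubleD IH; lia.
by have := gauss n.*2.+1; lia.
Qed.

(** The vector e_x - e_y for arbitrary x and y, zero or a negative root included, so that
    reflections act on labels without a case distinction. *)
Definition gap x y : lattice n := \row_h ((x <= h)%N%:Z - (y <= h)%N%:Z).

Lemma root_gap g : root g = gap (src g) (tgt g).
Proof.
apply/rowP => h; rewrite root_coord mxE /coef.
by have := src_lt_tgt g; rewrite /src /tgt; lia.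
Qed.

Lemma alpha_gap i : alpha i = gap i i.+1.
Proof.
apply/rowP => h; rewrite !mxE eqxx /=.
by have -> : (h == i) = (h == i :> nat) by []; lia.
Qed.

Lemma cartan_sum (f : nat -> int) i :
  \sum_(h < n.*2.+1) f h * cartan i h =
  2 * f i - (if i.+1 == n.*2.+1 then 0 else f i.+1) - (if i == 0%N :> nat then 0 else f i.-1).
Proof.
have pick_term m : \sum_(h < n.*2.+1) (f h * (h == m :> nat)%:Z) =
    if (m < n.*2.+1)%N then f m else 0.
  case: ltnP => lt_m.
    rewrite (bigD1 (Ordinal lt_m)) //= eqxx mulr1 big1 ?addr0 // => h hm.
    by rewrite (negPf (_ : (h != m :> nat))) ?mulr0.
  by rewrite big1 // => h _; rewrite (_ : (_ == _) = false) ?mulr0 //; have := ltn_ord h; lia.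
rewrite (eq_bigr (fun h : 'I__ => f h * (h == i :> nat)%:Z + f h * (h == i :> nat)%:Z
   - f h * (h == i.+1 :> nat)%:Z - (if i == 0%N :> nat then 0 else f h * (h == i.-1 :> nat)%:Z))).
  rewrite !sumrB big_split /= !pick_term (ltn_ord i) /=.
  rewrite (_ : (i.+1 < n.*2.+1)%N = (i.+1 != n.*2.+1)); last by have := ltn_ord i; lia.
  case: (i =P 0%N :> nat) => i0; first by rewrite big1_eq; case: eqP => _ /=; lia.
  rewrite pick_term (_ : (i.-1 < n.*2.+1)%N = true); last by have := ltn_ord i; lia.
  by case: eqP => _ /=; lia.
move=> h _; rewrite /cartan /far.
have -> : (i == h) = (i == h :> nat) by [].
have [E|E] := eqVneq (i : nat) h.
  by rewrite -E (_ : (i == i.+1 :> nat) = false) ?eqxx; case: eqP; lia.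
by case: ifP => E'; case: (i =P 0%N :> nat) => i0;
  rewrite ?(negPf (_ : h != i :> nat)) 1?eq_sym //; nia.
Qed.

Lemma refl_gap i x y : (x <= n.*2.+1)%N -> (y <= n.*2.+1)%N ->
  refl i (gap x y) = gap (sw i x) (sw i y).
Proof.
move=> x_le y_le.
have pairing : \sum_h gap x y 0 h * cartan i h =
    (2 * (x <= i)%N%:Z - (x < i)%N%:Z - (x <= i.+1)%N%:Z)
    - (2 * (y <= i)%N%:Z - (y < i)%N%:Z - (y <= i.+1)%N%:Z).
  pose f (h : nat) : int := (x <= h)%N%:Z - (y <= h)%N%:Z.
  rewrite (eq_bigr (fun h : 'I__ => f h * cartan i h)); last by move=> h _; rewrite mxE.
  by rewrite cartan_sum /f; have := ltn_ord i; repeat case: eqP; lia.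
rewrite /refl pairing; apply/rowP => h; rewrite !mxE eqxx /=.
have -> : (h == i) = (h == i :> nat) by [].
by case: eqP => [->|hi] /=; rewrite /sw; repeat case: eqP; nia.
Qed.

End Labels.

(** * Crossings of lines along a word *)

Section Crossings.

Import Order.TTheory GRing.Theory Num.Theory.
Local Open Scope ring_scope.

Variable n : nat.
Implicit Types (x y z p q t : nat) (i k : index n) (u v w : word n) (g h : posroot n)
  (xi : nat -> int) (pi : nat -> nat).

(* Inverse to each other: the line at position p, and the place of the line x,
   after reading u. *)
Fixpoint line_at u p : nat := if u is i :: u' then sw i (line_at u' p) else p.
Fixpoint place u x : nat := if u is i :: u' then place u' (sw i x) else x.

Lemma line_atK u : cancel (line_at u) (place u).
Proof. elim: u => //= i u IH p. by rewrite sw_inv IH. Qed.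

Lemma placeK u : cancel (place u) (line_at u).
Proof. by elim: u => //= i u IH x; rewrite IH sw_inv. Qed.

Lemma place_rcons u i x : place (rcons u i) x = sw i (place u x).
Proof. by elim: u x => //=. Qed.

Lemma line_at_le u p : (p <= n.*2.+1)%N -> (line_at u p <= n.*2.+1)%N.
Proof. by elim: u => //= i u IH /IH; apply: sw_le; exact: (ltn_ord i). Qed.

Lemma act_gap u p q : (p <= n.*2.+1)%N -> (q <= n.*2.+1)%N ->
  act u (gap n p q) = gap n (line_at u p) (line_at u q).
Proof.
by move=> p_le q_le; elim: u => //= i u ->; rewrite refl_gap ?line_at_le.
Qed.

Fixpoint crossings pi w : seq (nat * nat) :=
  if w is i :: u then (pi i, pi i.+1) :: crossings (pi \o sw i) u else [::].

Lemma size_crossings pi w : size (crossings pi w) = size w.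
Proof. by elim: w pi => //= i w IH pi; rewrite IH. Qed.

Lemma nth_crossings pi w t : (t < size w)%N ->
  nth (0, 0)%N (crossings pi w) t =
  (pi (line_at (take t w) (nth ord0 w t)), pi (line_at (take t w) (nth ord0 w t).+1)).
Proof. by elim: w pi t => // i w IH pi [|t] //= lt_t; rewrite IH. Qed.

Lemma beta_crossing w t : (t < size w)%N ->
  beta w t = gap n (nth (0, 0)%N (crossings id w) t).1 (nth (0, 0)%N (crossings id w) t).2.
Proof.
move=> lt_t; have lt_i := ltn_ord (nth ord0 w t).
by rewrite nth_crossings //= /beta alpha_gap act_gap // ltnW.
Qed.

Definition unordered (e : nat * nat) : nat * nat := (minn e.1 e.2, maxn e.1 e.2).

Lemma unordered_ends g : unordered (ends g) = ends g.
Proof.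
by have := src_lt_tgt g; rewrite /unordered /ends /=; case: ltngtP.
Qed.

Lemma sw_order i p q : p != q -> unordered (p, q) != (i : nat, i.+1) ->
  (sw i p < sw i q)%N = (p < q)%N.
Proof.
by rewrite /unordered xpair_eqE /sw /= => pq H; repeat case: ifP; lia.
Qed.

Lemma unordered_line_at u x y p q : unordered (place u x, place u y) = unordered (p, q) ->
  unordered (x, y) = unordered (line_at u p, line_at u q).
Proof.
move=> E; have : [/\ place u x = p & place u y = q] \/ [/\ place u x = q & place u y = p].
  by move: E; rewrite /unordered => -[] /=; lia.
case=> -[<- <-]; rewrite !placeK //.
by rewrite /unordered /= minnC maxnC.
Qed.

(** An adjacent transposition changes the relative order of no pair of lines other than the one it
    crosses. *)
Lemma place_order w x y t1 t2 : x != y -> (t1 <= t2 <= size w)%N ->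
  (forall t, (t1 <= t < t2)%N -> unordered (nth (0, 0)%N (crossings id w) t) != unordered (x, y)) ->
  (place (take t2 w) x < place (take t2 w) y)%N = (place (take t1 w) x < place (take t1 w) y)%N.
Proof.
move=> xy; elim: t2 => [|t2 IH] le_t ncross.
  by rewrite (_ : t1 = 0%N) //; lia.
have [->//|ne_t] := eqVneq t1 t2.+1.
rewrite -IH; [|lia|by move=> t ?; apply: ncross; lia].
rewrite (take_nth ord0) ?place_rcons; last by lia.
rewrite sw_order ?(can_eq (placeK _)) //.
apply: contra (ncross t2 _); last by lia.
move/eqP=> E; rewrite nth_crossings /=; last by lia.
apply/eqP/esym/unordered_line_at; rewrite E /unordered /=.
by congr (_, _); lia.
Qed.

Section Sweep.

Hypothesis n_gt0 : (0 < n)%N.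
Variables (xi : nat -> int) (w : word n).
Hypothesis sx : sweep xi w.

Lemma line_run xi0 u p : height n xi0 -> run xi0 u -> (p <= n.*2.+1)%N ->
  cls n (line n (after xi0 u) p) = cls n (line n xi0 (line_at u p)).
Proof.
elim: u xi0 => //= i u IH xi0 hx [r1 r2] p_le.
have i_le : (i <= n.*2)%N := ltn_ord i.
have hs : height n (step n xi0 i) by apply: height_step.
by rewrite IH // line_step // line_at_le.
Qed.

(** So w acts as w_0. The heights at the end are dual to those at the start, and [line_dual]
    reverses the positions; [separated] then turns equal classes into equal labels. *)
Lemma line_at_full p : (p <= n.*2.+1)%N -> line_at w p = (n.*2.+1 - p)%N.
Proof.
case: sx => hx sep rx ag _ p_le; apply: sep; rewrite ?line_at_le ?leq_subr //.
rewrite -line_run // -line_dual //; congr cls.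
exact: line_agree.
Qed.

Lemma place_full x : (x <= n.*2.+1)%N -> place w x = (n.*2.+1 - x)%N.
Proof.
move=> x_le; apply: (can_inj (line_atK w)).
by rewrite placeK line_at_full ?subKn // leq_subr.
Qed.

Let cross := crossings id w.

Lemma crossed g : ends g \in [seq unordered e | e <- cross].
Proof.
apply: contraT => ng; have lt_g := src_lt_tgt g; have le_g := tgt_le g.
have := @place_order w (src g) (tgt g) 0 (size w); rewrite take_size take0 => E.
have : (place w (src g) < place w (tgt g))%N = (src g < tgt g)%N.
  apply: E => [||t /andP[_ lt_t]]; [lia|lia|].
  apply: contraNneq ng; rewrite -/cross => E.
  rewrite -unordered_ends -E map_f // mem_nth // size_crossings //.
by rewrite !place_full; lia.
Qed.

(** All pairs of lines end up reversed, so each pair crosses, and w has exactly as many letters as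
    there are pairs. Hence no pair crosses twice. *)
Lemma crossings_once :
  uniq [seq unordered e | e <- cross] /\
  forall t, (t < size w)%N -> exists g, unordered (nth (0, 0)%N cross t) = ends g.
Proof.
pose E := [seq ends g | g <- enum {: posroot n}].
have uE : uniq E by rewrite map_inj_uniq ?enum_uniq //; exact: ends_inj.
have sE : {subset E <= [seq unordered e | e <- cross]}.
  by move=> _ /mapP[g _ ->]; exact: crossed.
have szE : (size [seq unordered e | e <- cross] <= size E)%N.
  by rewrite size_map [size E]size_map -cardE card_posroot size_crossings; case: sx => _ _ _ _ ->.
have [_ eqE] := uniq_min_size uE sE szE.
split; first exact: leq_size_uniq uE sE szE.
move=> t lt_t; have : unordered (nth (0, 0)%N cross t) \in E.
  by rewrite eqE map_f // mem_nth // size_crossings.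
by case/mapP=> g _ ->; exists g.
Qed.

Lemma unordered_nth_inj t t' : (t < size w)%N -> (t' < size w)%N ->
  unordered (nth (0, 0)%N cross t) = unordered (nth (0, 0)%N cross t') -> t = t'.
Proof.
have [u _] := crossings_once; have := uniqP (0, 0)%N u => inj lt_t lt_t' E.
by apply: inj; rewrite ?inE ?size_map ?size_crossings // !(nth_map (0, 0)%N) ?size_crossings.
Qed.

(** The two lines have not met before time t, so the smaller label is still on the left when they
    cross. *)
Lemma crossing_ends t : (t < size w)%N -> exists g, nth (0, 0)%N cross t = ends g.
Proof.
move=> lt_t; have [_ /(_ t lt_t)[g Eg]] := crossings_once; exists g.
have lt_g := src_lt_tgt g.
have ord : (place (take t w) (src g) < place (take t w) (tgt g))%N.
  rewrite (@place_order w _ _ 0 t) ?take0 //; [by lia|by lia|].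
  move=> t' lt_t'; apply/eqP; rewrite (_ : unordered (src g, tgt g) = ends g); last exact: unordered_ends.
  by rewrite -Eg => /unordered_nth_inj; lia.
move: Eg; rewrite /cross nth_crossings //=.
set i := nth _ _ _; set a := line_at _ _; set b := line_at _ _.
have pa : place (take t w) a = i by exact: line_atK.
have pb : place (take t w) b = i.+1 by exact: line_atK.
rewrite /unordered /=; case: ltngtP => [ab|ab|->] // [E1 E2].
by move: ord; rewrite -E1 -E2 pa pb; lia.
Qed.

Lemma ends_crossing g : ends g \in cross.
Proof.
have /mapP[e /(nthP (0, 0)%N)[t lt_t <-]] := crossed g.
rewrite size_crossings in lt_t; have [h Eh] := crossing_ends lt_t.
by rewrite Eh unordered_ends => ->; rewrite -Eh mem_nth ?size_crossings.
Qed.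

Lemma crossings_uniq : uniq cross.
Proof. by have [/map_uniq] := crossings_once. Qed.

Definition rank g := seq.index (ends g) cross.

Lemma rank_lt g : (rank g < size w)%N.
Proof. by rewrite -(size_crossings id) seq.index_mem ends_crossing. Qed.

Lemma nth_rank g : nth (0, 0)%N cross (rank g) = ends g.
Proof. by rewrite nth_index ?ends_crossing. Qed.

Lemma rank_nth t g : (t < size w)%N -> nth (0, 0)%N cross t = ends g -> rank g = t.
Proof. by move=> lt_t E; rewrite /rank -E index_uniq ?size_crossings ?crossings_uniq. Qed.

Lemma rank_inj : injective rank.
Proof. by move=> g h E; apply: ends_inj; rewrite -!nth_rank E. Qed.

Lemma beta_rank g : beta w (rank g) = root g.
Proof. by rewrite beta_crossing ?rank_lt // nth_rank -root_gap. Qed.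

Lemma rank_ex t : (t < size w)%N -> exists g, rank g = t.
Proof. by move=> lt_t; have [g /rank_nth] := crossing_ends lt_t; exists g; auto. Qed.

Lemma place_rank g t : (t <= size w)%N ->
  (place (take t w) (tgt g) < place (take t w) (src g))%N = (rank g < t)%N.
Proof.
move=> le_t; have lt_g := src_lt_tgt g; have lt_r := rank_lt g.
have le_g := tgt_le g.
have nth_ne t' : (t' < size w)%N -> t' != rank g ->
    unordered (nth (0, 0)%N cross t') != unordered (tgt g, src g).
  move=> lt_t'; apply: contra_neq => E; apply: unordered_nth_inj => //.
  by rewrite E nth_rank /unordered /= minnC maxnC.
case: (ltnP (rank g) t) => le_r.
  rewrite -(@place_order w _ _ t (size w)); [|lia|lia|by move=> t' ?; apply: nth_ne; lia].
  by rewrite take_size !place_full; lia.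
rewrite (@place_order w _ _ 0 t); [|lia|lia|by move=> t' ?; apply: nth_ne; lia].
by rewrite take0 /=; lia.
Qed.

(** Convexity of the order of roots: compare the order of the three lines just before and just after
    the outer two cross. Were the middle line crossed by both others earlier, or by both later, one
    of these orders would not be transitive. *)
Lemma rank_convex g1 g2 g3 : tgt g1 = src g2 -> src g3 = src g1 -> tgt g3 = tgt g2 ->
  (rank g1 < rank g3 < rank g2)%N || (rank g2 < rank g3 < rank g1)%N.
Proof.
move=> E1 E2 E3; have := (place_rank g1, place_rank g2, place_rank g3) => -[[P1 P2] P3].
have lt3 := rank_lt g3.
have := (P1 _ (ltnW lt3), P2 _ (ltnW lt3), P3 _ (ltnW lt3), P1 _ lt3, P2 _ lt3, P3 _ lt3).
rewrite E1 E2 E3 => -[[[[[]]]]].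
have ne13 : rank g1 != rank g3.
  by apply: contra_eq_neq E3 => /rank_inj <-; have := src_lt_tgt g2; rewrite E1; lia.
have ne23 : rank g2 != rank g3.
  by apply: contra_eq_neq E2 => /rank_inj <-; have := src_lt_tgt g1; rewrite E1; lia.
by lia.
Qed.

End Sweep.

End Crossings.

(** * Coordinates of roots *)

Section Coordinates.

Import Order.TTheory GRing.Theory Num.Theory.
Local Open Scope ring_scope.

Variable n : nat.
Hypothesis n_gt0 : (0 < n)%N.
Implicit Types (x y z p q t : nat) (i k : index n) (u v w j : word n) (g h : posroot n)
  (xi : nat -> int) (pi : nat -> nat) (c : int * int).

Lemma comm_trans u v w : comm_equiv u v -> comm_equiv v w -> comm_equiv u w.
Proof. by move=> uv; elim=> // a b i k ik _; exact: comm_swap. Qed.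

Lemma comm_cons i u v : comm_equiv u v -> comm_equiv (i :: u) (i :: v).
Proof.
elim=> [|a b k l kl _ IH]; first exact: comm_refl.
by have := @comm_swap n (i :: u) (i :: a) b k l kl IH.
Qed.

Fixpoint trace pi xi w : seq ((nat * nat) * (int * int)) :=
  if w is i :: u then
    ((pi i, pi i.+1), (xi i - width n i, xi i + width n i))
    :: trace (pi \o sw i) (step n xi i) u
  else [::].

Definition coords xi w := unzip2 (trace id xi w).

Lemma trace_crossings pi xi w : unzip1 (trace pi xi w) = crossings pi w.
Proof. by elim: w pi xi => //= i w IH pi xi; rewrite IH. Qed.

Lemma trace_ext pi pi' xi xi' w : pi =1 pi' -> agree n xi xi' ->
  trace pi xi w = trace pi' xi' w.
Proof.
elim: w pi pi' xi xi' => //= i w IH pi pi' xi xi' E1 E2.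
rewrite !E1 E2; last exact: (ltn_ord i).
by congr (_ :: _); apply: IH => [x|]; [exact: E1|exact: step_agree].
Qed.

Lemma coords_pi pi xi w : unzip2 (trace pi xi w) = coords xi w.
Proof.
rewrite /coords; move: id => pi'; elim: w pi pi' xi => //= i w IH pi pi' xi.
by congr (_ :: _); apply: IH.
Qed.

(** A commutation exchanges two entries without changing them, so the coordinates of a root depend
    on the class only. *)
Lemma perm_trace pi xi w w' : comm_equiv w w' -> perm_eq (trace pi xi w) (trace pi xi w').
Proof.
elim=> // u v i k ik _ H; apply: perm_trans H _ => {w w'}.
elim: u pi xi => [|l u IH] pi xi /=; last by rewrite perm_cons; exact: IH.
have [E1 E2] : sw i k = k /\ sw i k.+1 = k.+1.
  by move: ik; rewrite /sw /far => ?; split; repeat case: ifP; lia.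
have [E3 E4] : sw k i = i /\ sw k i.+1 = i.+1.
  by move: ik; rewrite /sw /far => ?; split; repeat case: ifP; lia.
have ki : (k : nat) != i by move: ik; rewrite /far; lia.
have S1 : step n xi i k = xi k by rewrite /step (negPf ki).
have S2 : step n xi k i = xi i by rewrite /step eq_sym (negPf ki).
rewrite E1 E2 E3 E4 S1 S2 -[X in perm_eq X]/([:: _] ++ [:: _] ++ _) perm_catCA /= !perm_cons.
rewrite (@trace_ext _ (pi \o sw k \o sw i) _ (step n (step n xi k) i)) //.
  by move=> p /=; congr pi; move: ik; rewrite /sw /far; repeat case: ifP; lia.
by move=> l _; apply: step_comm; rewrite eq_sym.
Qed.

Lemma height_near xi i k : height n xi -> (k = i.+1 :> nat) ->
  (xi i < xi k -> width n k - width n i <= xi k - xi i) /\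
  (xi k < xi i -> width n k - width n i <= xi i - xi k).
Proof.
move=> [G1 _ G3] E; have lt_k := ltn_ord k; rewrite {}E in lt_k *.
have [ni|ni] := eqVneq (i : nat) n.
  by rewrite ni /width; case: G3 => -[E1 E2]; repeat case: ifP; lia.
have [ni1|ni1] := eqVneq i.+1 n.
  have in1 : (i : nat) = n.-1 by lia.
  by rewrite ni1 in1 /width; case: G3 => -[E1 E2]; repeat case: ifP; lia.
by have := G1 i lt_k ni ni1; rewrite /width; repeat case: ifP; lia.
Qed.

(** Neighbouring letters that do not commute are already in order for both coordinates. Hence
    sorting by any order that extends the componentwise one exchanges commuting letters only. *)
Lemma near_mono xi i k : height n xi -> ready n xi i -> ~~ far i k ->
  xi i - width n i <= step n xi i k - width n k /\
  xi i + width n i <= step n xi i k + width n k.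
Proof.
move=> hx [r1 r2] nfar; rewrite /step.
case: (eqVneq (k : nat) i) => [->|ki]; first by rewrite /jump; case: ifP; lia.
have [E|E] : (k = i.+1 :> nat) \/ (i = k.+1 :> nat) by move: nfar; rewrite /far; lia.
  have := r2; rewrite -E => /(_ _) H.
  have {}H : xi i < xi k by apply: H; have := ltn_ord k; lia.
  have [/(_ H)] := height_near hx E; rewrite /width.
  by repeat case: ifP; lia.
have := r1; rewrite E => /(_ isT) /= H.
have [_ /(_ _)] := height_near hx E; rewrite E => /(_ H); rewrite /width.
by repeat case: ifP; lia.
Qed.

(** * Sorting a word by commutations *)

Section Sorting.

Variable r : rel (int * int).
Hypotheses (r_total : total r) (r_trans : transitive r)
  (r_mono : forall c c', c.1 <= c'.1 -> c.2 <= c'.2 -> r c c').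

(** One round of insertion sort: if i and the letter after it are out of order for [r], they commute
    by [near_mono], and i moves on past it. *)
Lemma insert_letter xi i u : height n xi -> run xi (i :: u) ->
  sorted r (coords (step n xi i) u) ->
  exists2 u', comm_equiv (i :: u) u' & sorted r (coords xi u').
Proof.
elim: u xi => [|k v IH] xi hx rx srt; first by exists [:: i] => //; exact: comm_refl.
set c := (xi i - width n i, xi i + width n i).
set c' := (step n xi i k - width n k, step n xi i k + width n k).
have [rcc|nrcc] := boolP (r c c').
  exists [:: i, k & v]; first exact: comm_refl.
  rewrite /coords /= coords_pi; move: srt; rewrite /coords /= !coords_pi => srt.
  by apply/andP.
have ik : far i k.
  apply: contraR nrcc => nf; have [_ _] := rx.
  by have [] := @near_mono xi i k hx _ nf; [case: rx|move=> *; exact: r_mono].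
have ki : (k : nat) != i by move: ik; rewrite /far; lia.
have rx' := run_swap n_gt0 ik rx.
have ag : agree n (step n (step n xi i) k) (step n (step n xi k) i).
  by move=> l _; apply: step_comm; rewrite eq_sym.
have k_le : (k <= n.*2)%N := ltn_ord k.
have srt' : path r c' (coords (step n (step n xi k) i) v).
  move: srt; rewrite /coords /= !coords_pi -/c'.
  by rewrite /coords (trace_ext (pi' := id) v _ ag).
have [|||v' vv' srtv] := IH (step n xi k).
- by apply: height_step => //; case: rx'.
- by case: rx'.
- exact: path_sorted srt'.
exists (k :: v').
  apply: comm_trans (comm_cons k vv').
  apply: (@comm_swap n [:: i, k & v] [::] v i k ik); exact: comm_refl.
rewrite /coords /= coords_pi path_sortedE // srtv andbT.
have -> : (xi k - width n k, xi k + width n k) = c' by rewrite /c' /step (negPf ki).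
have pm : perm_eq (coords (step n xi k) (i :: v)) (coords (step n xi k) v').
  exact/perm_map/perm_trace.
rewrite -(perm_all _ pm) /coords /= coords_pi.
have -> : (step n xi k i - width n i, step n xi k i + width n i) = c.
  by rewrite /c /step eq_sym (negPf ki).
apply/andP; split; last by move: srt'; rewrite path_sortedE // => /andP[].
by have := r_total c c'; rewrite (negPf nrcc).
Qed.

Lemma sorted_word xi w : height n xi -> run xi w ->
  exists2 j, comm_equiv w j & sorted r (coords xi j).
Proof.
elim: w xi => [|i u IH] xi hx rx; first by exists [::] => //; exact: comm_refl.
have [r1 r2] := rx.
have hs : height n (step n xi i) by apply: height_step => //; exact: (ltn_ord i).
have [u' uu' srt] := IH _ hs r2.
have rx' : run xi (i :: u') by split=> //; exact: run_comm uu' r2.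
have [j uj srtj] := insert_letter hx rx' srt.
by exists j => //; apply: comm_trans uj; exact: comm_cons.
Qed.

End Sorting.

End Coordinates.

(** * Position of the chords in the plane of coordinates *)

Section Geometry.

Import Order.TTheory GRing.Theory Num.Theory.
Local Open Scope ring_scope.

Variable n : nat.
Hypothesis n_gt0 : (0 < n)%N.
Implicit Types (x y z p q t : nat) (i k : nat) (u v w j : word n) (g h : posroot n)
  (xi : nat -> int) (pi : nat -> nat) (S T : int).

Lemma after_ge xi w k : xi k <= after xi w k.
Proof.
elim: w xi => //= i w IH xi; apply: le_trans (IH _); rewrite /step /jump.
by repeat case: ifP; lia.
Qed.

Lemma height_up xi i k : height n xi -> (i <= k)%N -> (k <= n.*2)%N ->
  (k < n)%N || (n < i)%N ->
  xi k <= xi i + 2 * (k - i)%N%:Z /\ xi i <= xi k + 2 * (k - i)%N%:Z.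
Proof.
move=> [G1 _ _]; elim: k => [|k IH] le_ik le_k side.
  by rewrite (_ : i = 0%N); lia.
have [->|ne_ik] := eqVneq i k.+1; first by lia.
have := IH _ _ _; have := G1 k.
by move=> H1 H2; have := H1 _ _ _; have := H2 _ _ _; lia.
Qed.

(** Heights vary no faster than [width]. The residue n is jumped over: between n - 1 and n + 1 both
    quantities change by exactly 2. *)
Lemma height_slope xi i k : height n xi -> (i <= n.*2)%N -> (k <= n.*2)%N ->
  i != n -> k != n -> xi k <= xi i + `|width n k - width n i|.
Proof.
move=> hx i_le k_le ni nk; have [_ _ G3] := hx.
have mid : xi n.-1 = xi n.+1 + 2 \/ xi n.+1 = xi n.-1 + 2.
  by case: G3 => -[-> ->]; lia.
have [ii|ii] := ltnP i n; have [kk|kk] := ltnP k n.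
- case: (leqP i k) => ik.
    by have := @height_up xi i k hx ik k_le; rewrite kk /width ii kk; lia.
  by have := @height_up xi k i hx (ltnW ik) i_le; rewrite ii /width ii kk; lia.
- have := @height_up xi i n.-1 hx; have := @height_up xi n.+1 k hx.
  by move=> H1 H2; have := H1 _ _ _; have := H2 _ _ _; rewrite /width; repeat case: ifP; lia.
- have := @height_up xi k n.-1 hx; have := @height_up xi n.+1 i hx.
  by move=> H1 H2; have := H1 _ _ _; have := H2 _ _ _; rewrite /width; repeat case: ifP; lia.
- case: (leqP i k) => ik.
    have := @height_up xi i k hx ik k_le; rewrite /width.
    by move=> H; have := H _; repeat case: ifP; lia.
  have := @height_up xi k i hx (ltnW ik) i_le; rewrite /width.
  by move=> H; have := H _; repeat case: ifP; lia.
Qed.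

(** The times at which the residue i can occur, that is [xi i] modulo [jump i]. *)
Definition on_grid xi i S : Prop :=
  if i == n then ((S - xi n) %% 2)%Z = 0 else ((S - width n i) %% 4)%Z = 0.

(** A grid point in the cone above a crossing still to come is still to come, by the slope bound.
    Starting from the residue n the bound may be too weak by 2, which the congruence modulo 4 makes
    up for. *)
Lemma upward_closed xi i k S T : height n xi -> (i <= n.*2)%N -> (k <= n.*2)%N ->
  on_grid xi i S -> on_grid xi k T ->
  xi i <= S -> `|width n k - width n i| <= T - S -> xi k <= T.
Proof.
move=> hx i_le k_le; have [_ G2 G3] := hx.
have G2n := G2 n.-1; have G2m := G2 n.+1; have G2k := G2 k k_le.
have wn : width n n = (n.*2.+1)%:Z by rewrite /width ltnn eqxx.
have wp : width n n.-1 = 2 * n%:Z by rewrite /width; repeat case: ifP; lia.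
have ws : width n n.+1 = 2 * n.+1%:Z by rewrite /width; repeat case: ifP; lia.
have {}G2n : ((xi n.-1 - 2 * n%:Z) %% 4)%Z = 0 by rewrite -wp; apply: G2n; lia.
have {}G2m : ((xi n.+1 - 2 * n.+1%:Z) %% 4)%Z = 0 by rewrite -ws; apply: G2m; lia.
rewrite /on_grid; have [->|ni] := eqVneq i n; have [->|nk] := eqVneq k n.
- by lia.
- move=> gS gT le_S le_T; have {}G2k := G2k nk.
  have [kk|kk] := ltnP k n.
    have sl := @height_slope xi n.-1 k hx; have wk : width n k = 2 * k.+1%:Z by rewrite /width kk.
    have {}sl : xi k <= xi n.-1 + `|width n k - width n n.-1| by apply: sl; lia.
    by move: sl le_T G2k gT; rewrite wn wp wk; case: G3 => -[E1 E2]; lia.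
  have sl := @height_slope xi n.+1 k hx.
  have wk : width n k = 2 * k%:Z by rewrite /width; repeat case: ifP; lia.
  have {}sl : xi k <= xi n.+1 + `|width n k - width n n.+1| by apply: sl; lia.
  by move: sl le_T G2k gT; rewrite wn ws wk; case: G3 => -[E1 E2]; lia.
- move=> gS gT le_S le_T.
  have [ii|ii] := ltnP i n.
    have sl := @height_slope xi i n.-1 hx; have wi : width n i = 2 * i.+1%:Z by rewrite /width ii.
    have {}sl : xi n.-1 <= xi i + `|width n n.-1 - width n i| by apply: sl; lia.
    by move: sl le_T; rewrite wn wp wi; case: G3 => -[E1 E2]; lia.
  have sl := @height_slope xi i n.+1 hx.
  have wi : width n i = 2 * i%:Z by rewrite /width; repeat case: ifP; lia.
  have {}sl : xi n.+1 <= xi i + `|width n n.+1 - width n i| by apply: sl; lia.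
  by move: sl le_T; rewrite wn ws wi; case: G3 => -[E1 E2]; lia.
- by move=> _ _; have := height_slope hx i_le k_le ni nk; lia.
Qed.

Lemma trace_record xi0 pi xi w e : height n xi -> run xi w ->
  (forall k, (k <= n.*2)%N -> xi0 k <= xi k) -> ((xi n - xi0 n) %% 2)%Z = 0 ->
  (forall p, (p <= n.*2.+1)%N -> cls n (line n xi p) = cls n (line n xi0 (pi p))) ->
  e \in trace pi xi w ->
  exists2 i, (i <= n.*2)%N & exists S,
    [/\ e.2 = (S - width n i, S + width n i), xi0 i <= S, S + jump n i <= after xi w i,
        on_grid xi0 i S
      & cls n e.2.1 = cls n (line n xi0 e.1.1) /\ cls n e.2.2 = cls n (line n xi0 e.1.2)].
Proof.
elim: w pi xi => // l w IH pi xi hx rx le_xi par lines.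
have l_le : (l <= n.*2)%N := ltn_ord l.
have [r1 r2] := rx; rewrite /= in_cons => /orP[/eqP->|e_in].
  exists (nat_of_ord l) => //; exists (xi l); split=> //=.
  - exact: le_xi.
  - by have := after_ge (step n xi l) w l; rewrite {1}/step eqxx.
  - rewrite /on_grid; case: eqP => [->//|/eqP nl].
    by have [_ G2 _] := hx; exact: G2.
  - rewrite -!lines; [|lia|lia].
    by rewrite (line_left n_gt0 l_le r1) (line_right n_gt0 l_le r1).
apply: IH e_in => //.
- exact: height_step.
- by move=> k k_le; have := le_xi k k_le; rewrite /step /jump; repeat case: ifP; lia.
- by move: par; rewrite /step /jump; case: eqP => [<-|_]; rewrite ?eqxx; lia.
- by move=> p p_le; rewrite line_step // lines // sw_le.
Qed.

Definition crd xi w g : int * int := nth (0, 0) (coords xi w) (rank w g).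

Section Sweep.

Variables (xi : nat -> int) (w : word n).
Hypothesis sx : sweep xi w.

Lemma crd_trace g : (ends g, crd xi w g) \in trace id xi w.
Proof.
have sz : size (trace id xi w) = size w.
  by rewrite -(size_map fst) [map _ _]trace_crossings size_crossings.
have lt_r : (rank w g < size (trace id xi w))%N by rewrite sz (rank_lt n_gt0 sx).
pose e := nth ((0, 0)%N, (0, 0)) (trace id xi w) (rank w g).
have <- : e.1 = ends g.
  by rewrite -(nth_map _ (0, 0)%N fst) // [map _ _]trace_crossings (nth_rank n_gt0 sx).
have <- : e.2 = crd xi w g by rewrite /crd /coords (nth_map ((0, 0)%N, (0, 0))).
by rewrite -surjective_pairing mem_nth.
Qed.

Lemma crd_trace_comm j g : comm_equiv w j -> nth (0, 0) (coords xi j) (rank j g) = crd xi w g.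
Proof.
move=> wj; have sj := sweep_comm n_gt0 wj sx.
have sz : size (trace id xi j) = size j.
  by rewrite -(size_map fst) [map _ _]trace_crossings size_crossings.
have := crd_trace g; rewrite (perm_mem (perm_trace n_gt0 _ _ wj)).
case/(nthP ((0, 0)%N, (0, 0))) => t; rewrite sz => lt_t E.
have -> : rank j g = t.
  apply: (rank_nth n_gt0 sj) => //.
  by rewrite -(trace_crossings _ xi) (nth_map ((0, 0)%N, (0, 0))) ?sz // E.
by rewrite /coords (nth_map ((0, 0)%N, (0, 0))) ?sz // E.
Qed.

Notation cA g := (crd xi w g).1.
Notation cB g := (crd xi w g).2.

Lemma crdP g : exists2 i, (i <= n.*2)%N & exists S,
  [/\ cA g = S - width n i, cB g = S + width n i, on_grid xi i S,
      xi i <= S /\ S + jump n i <= xi (n.*2 - i)%N + full_turn n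
    & cls n (cA g) = cls n (line n xi (src g)) /\ cls n (cB g) = cls n (line n xi (tgt g))].
Proof.
have [hx _ rx ag _] := sx.
have par : ((xi n - xi n) %% 2)%Z = 0 by rewrite subrr.
have [i i_le [S [E le1 le2 gr cl]]] := @trace_record xi id xi w _ hx rx
  (fun k _ => lexx (xi k)) par (fun p _ => erefl _) (crd_trace g).
exists i => //; exists S; rewrite /= in E cl; rewrite E /= in cl *.
by split=> //; rewrite -[_ + full_turn n]ag.
Qed.

Lemma on_grid_dual i S : (i <= n.*2)%N -> on_grid xi i S ->
  on_grid xi (n.*2 - i)%N (S - full_turn n).
Proof.
move=> i_le; rewrite /on_grid width_dual // /full_turn /width.
have -> : (n.*2 - i == n)%N = (i == n) by lia.
by repeat case: ifP; lia.
Qed.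

(* The two lines of [g] cross again, half a turn later, at [(cB g, cA g + period n)],
   and no root of the sweep lies beyond this point. *)
Lemma one_turn g h : ~ (cB g <= cA h /\ cA g + period n <= cB h).
Proof.
have [hx _ _ _ _] := sx.
have [i i_le [S [-> EB grS [le1 _] _]]] := crdP g.
have [k k_le [T [-> -> grT [_ le2] _]]] := crdP h; rewrite EB.
(* The copy of [h] half a [period] earlier lies in the cone above [g], so it does not precede the
   start; then [h] itself does not precede the end of the sweep. *)
case=> H1 H2; have : xi (n.*2 - k)%N <= T - full_turn n.
  apply: upward_closed hx i_le _ grS (on_grid_dual k_le grT) le1 _; first exact: leq_subr.
  by rewrite width_dual //; move: H1 H2; rewrite /period /full_turn; lia.
by move: le2; rewrite /jump; case: ifP; lia.
Qed.

(** The label carried by the center. *)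
Definition odd_label o : Prop :=
  [/\ o = n \/ o = n.+1, (line n xi o %% 4)%Z != 0
    & forall p, (p <= n.*2.+1)%N -> p != o -> (line n xi p %% 4)%Z = 0].

Lemma odd_label_ex : exists o, odd_label o.
Proof.
have [[_ G2 G3] _ _ _ _] := sx.
have wn : width n n = (n.*2.+1)%:Z by rewrite /width ltnn eqxx.
have wp : width n n.-1 = 2 * n%:Z by rewrite /width; repeat case: ifP; lia.
have ws : width n n.+1 = 2 * n.+1%:Z by rewrite /width; repeat case: ifP; lia.
have G2n : ((xi n.-1 - 2 * n%:Z) %% 4)%Z = 0 by rewrite -wp; apply: G2; lia.
have G2m : ((xi n.+1 - 2 * n.+1%:Z) %% 4)%Z = 0 by rewrite -ws; apply: G2; lia.
have other p : (p <= n.*2.+1)%N -> p != n -> p != n.+1 -> (line n xi p %% 4)%Z = 0.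
  move=> p_le pn pn1; rewrite /line; case: eqP => [_|/eqP p0].
    by apply: G2; lia.
  have even q : (q <= n.*2)%N -> q != n -> ((xi q + width n q) %% 4)%Z = 0.
    by move=> q_le qn; have := G2 q q_le qn; rewrite /width (negPf qn); case: ifP; lia.
  case: eqP => [_|/eqP p1]; first by apply: even; lia.
  by case: ifP => _; [apply: G2|apply: even]; lia.
have ln : line n xi n = if xi n < xi n.-1 then xi n - width n n else xi n.-1 + width n n.-1.
  by rewrite /line; repeat case: eqP; lia.
have ln1 : line n xi n.+1 = if xi n.+1 < xi n then xi n.+1 - width n n.+1 else xi n + width n n.
  by rewrite /line /=; repeat case: eqP; lia.
have [[a b]|[a b]] : [/\ (line n xi n %% 4)%Z = 0 & (line n xi n.+1 %% 4)%Z != 0] \/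
    [/\ (line n xi n %% 4)%Z != 0 & (line n xi n.+1 %% 4)%Z = 0].
  by rewrite ln ln1 wn wp ws; case: G3 => -[E1 E2]; repeat case: ifP; lia.
- exists n.+1; split=> //; first by right.
  by move=> p p_le pn1; have [->//|pn] := eqVneq p n; exact: other.
- exists n; split=> //; first by left.
  by move=> p p_le pn; have [->//|pn1] := eqVneq p n.+1; exact: other.
Qed.

Lemma crd_even o g : odd_label o ->
  ((cA g %% 4)%Z == 0) = (src g != o) /\ ((cB g %% 4)%Z == 0) = (tgt g != o).
Proof.
move=> [_ odd_o even]; have [i i_le [S [_ _ _ _ [E1 E2]]]] := crdP g.
have lt_g := src_lt_tgt g; have le_g := tgt_le g.
have alt x (c : int) : (x <= n.*2.+1)%N -> cls n c = cls n (line n xi x) ->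
    ((c %% 4)%Z == 0) = (x != o).
  move=> x_le /cls_eq; have [->|xo] := eqVneq x o.
    by case=> [[/negPf->]|[_ E]] //; rewrite E eqxx in odd_o.
  by case=> [[_]|[->]]; rewrite ?eqxx ?even.
by split; apply: alt => //; lia.
Qed.

(** A root through the center joins a vertex to the point opposite to it, whence the exact width of
    half a [period]. In the code this follows from the parities of the two coordinates. *)
Lemma crd_width o g : odd_label o ->
  [/\ 0 < cB g - cA g, cB g - cA g < period n
    & src g = o \/ tgt g = o -> cB g - cA g = full_turn n].
Proof.
move=> oo; have [-> ->] : 0 < cB g - cA g /\ cB g - cA g < period n.
  have [i i_le [S [-> -> _ _ _]]] := crdP g.
  by rewrite /period /width; repeat case: ifP; lia.
split=> // H; have [E1 E2] := crd_even g oo; have [i i_le [S [EA EB gr _ _]]] := crdP g.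
have [ni|ni] := eqVneq i n.
  by rewrite EA EB ni /width ltnn eqxx /full_turn; lia.
move: gr E1 E2; rewrite /on_grid (negPf ni) EA EB; case: H => ->; rewrite eqxx.
  by rewrite /width (negPf ni); case: ifP; lia.
by rewrite /width (negPf ni); case: ifP; lia.
Qed.

Lemma crd_middle o g : odd_label o -> src g = o \/ tgt g = o -> exists S,
  [/\ cA g = S - (n.*2.+1)%:Z, cB g = S + (n.*2.+1)%:Z, ((S - xi n) %% 2)%Z = 0,
      xi n <= S & S + 2 <= xi n + full_turn n].
Proof.
move=> oo H; have [_ _ /(_ H) W] := crd_width g oo.
have [i i_le [S [EA EB gr [le1 le2] _]]] := crdP g.
have [ni|ni] := eqVneq i n.
  subst i; exists S; move: gr le2 EA EB.
  rewrite /on_grid /width /jump ltnn eqxx (_ : n.*2 - n = n)%N; last by lia.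
  by split.
have := crd_even g oo; move: gr; rewrite /on_grid (negPf ni).
move: W; rewrite EA EB /width (negPf ni) /full_turn.
by case: ifP; lia.
Qed.

Lemma crd_label g h : cls n (cA g) = cls n (cA h) -> cls n (cB g) = cls n (cB h) -> g = h.
Proof.
have [_ sep _ _ _] := sx.
have [i _ [S [_ _ _ _ [-> ->]]]] := crdP g; have [k _ [T [_ _ _ _ [-> ->]]]] := crdP h.
have lt_g := src_lt_tgt g; have le_g := tgt_le g.
have lt_h := src_lt_tgt h; have le_h := tgt_le h.
move=> E1 E2; apply: ends_inj; congr (_, _).
  by apply: (sep _ _ _ _ E1); lia.
by apply: (sep _ _ _ _ E2); lia.
Qed.

End Sweep.

End Geometry.

(** * Intervals of the convex order *)

Section Intervals.

Import Order.TTheory GRing.Theory Num.Theory.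
Local Open Scope ring_scope.

Variable n : nat.
Hypothesis n_gt0 : (0 < n)%N.
Implicit Types (x y z p q t : nat) (i k : nat) (u v w j : word n) (a b g h : posroot n)
  (xi : nat -> int).

(** The open interval of the pair. Which of a and b comes first may depend on the word. *)
Definition between w a b g : Prop := forall j, comm_equiv w j ->
  (rank j a < rank j g < rank j b)%N || (rank j b < rank j g < rank j a)%N.

Lemma betweenC w a b g : between w a b g -> between w b a g.
Proof. by move=> H j /H; rewrite orbC. Qed.

Section Sweep.

Variables (xi : nat -> int) (w : word n).
Hypothesis sx : sweep xi w.

Notation cA g := (crd xi w g).1.
Notation cB g := (crd xi w g).2.

Definition beforeA g h : Prop := cA g < cA h \/ (cA g = cA h /\ cB g < cB h).
Definition beforeB g h : Prop := cB g < cB h \/ (cB g = cB h /\ cA g < cA h).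

(** Both lexicographic orders extend the componentwise one, so [sorted_word] applies to each; ties
    are excluded since the coordinates determine the root. *)
Lemma lex_words :
  (exists2 j, comm_equiv w j & forall g h, (rank j g < rank j h)%N -> beforeA g h) /\
  (exists2 j, comm_equiv w j & forall g h, (rank j g < rank j h)%N -> beforeB g h).
Proof.
have [hx _ rx _ _] := sx.
have gen (r : rel (int * int)) : total r -> transitive r ->
    (forall c c' : int * int, c.1 <= c'.1 -> c.2 <= c'.2 -> r c c') ->
    exists2 j, comm_equiv w j & forall g h, (rank j g < rank j h)%N ->
      r (crd xi w g) (crd xi w h) /\ (cA g != cA h) || (cB g != cB h).
  move=> tot tr mono; have [j wj srt] := sorted_word n_gt0 tot tr mono hx rx.
  exists j => // g h lt_gh; have sj := sweep_comm n_gt0 wj sx; split.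
    rewrite -!(crd_trace_comm n_gt0 sx _ wj).
    have sz : size (coords xi j) = size j.
      by rewrite size_map -(size_map fst) [map _ _]trace_crossings size_crossings.
    apply: (sorted_ltn_nth tr); rewrite ?inE ?sz //; exact: (rank_lt n_gt0 sj).
  rewrite -negb_and; apply/negP => /andP[/eqP E1 /eqP E2].
  have E : g = h by apply: (crd_label n_gt0 sx); rewrite ?E1 ?E2.
  by rewrite E ltnn in lt_gh.
split.
  have [|||j wj H] := gen (fun c c' => (c.1 < c'.1) || ((c.1 == c'.1) && (c.2 <= c'.2))).
  - by move=> [c1 c2] [d1 d2] /=; lia.
  - by move=> [c1 c2] [d1 d2] [e1 e2] /=; lia.
  - by move=> [c1 c2] [d1 d2] /=; lia.
  by exists j => // g h /H[]; rewrite /beforeA; lia.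
have [|||j wj H] := gen (fun c c' => (c.2 < c'.2) || ((c.2 == c'.2) && (c.1 <= c'.1))).
- by move=> [c1 c2] [d1 d2] /=; lia.
- by move=> [c1 c2] [d1 d2] [e1 e2] /=; lia.
- by move=> [c1 c2] [d1 d2] /=; lia.
by exists j => // g h /H[]; rewrite /beforeB; lia.
Qed.

Lemma between_lex a b g : between w a b g ->
  (beforeA a g /\ beforeA g b \/ beforeA b g /\ beforeA g a) /\
  (beforeB a g /\ beforeB g b \/ beforeB b g /\ beforeB g a).
Proof.
have [[jA wA HA] [jB wB HB]] := lex_words; move=> H; split.
  by case/orP: (H _ wA) => /andP[/HA H1 /HA H2]; [left|right].
by case/orP: (H _ wB) => /andP[/HB H1 /HB H2]; [left|right].
Qed.

Lemma multiple_cases (k q : int) : 0 < q ->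
  k * q = 0 \/ k * q = q \/ k * q = - q \/ k * q >= 2 * q \/ k * q <= - (2 * q).
Proof.
move=> q0; have [->|[->|[->|[k2|k2]]]] : k = 0 \/ k = 1 \/ k = -1 \/ k >= 2 \/ k <= -2 by lia.
- by lia.
- by lia.
- by lia.
- by have := ler_wpM2r (ltW q0) k2; lia.
- by have := ler_wpM2r (ltW q0) k2; lia.
Qed.

(** A weak form of congruence modulo [period] made of linear conditions. Differences of two or more
    turns are only bounded, being excluded by size alone. *)
Definition congruent (c d : int) : Prop :=
  c = d \/ c = d + period n \/ c = d - period n \/ c >= d + 2 * period n \/
  c <= d - 2 * period n.

Lemma cls_congruent c d : cls n c = cls n d -> (c %% 4)%Z = 0 -> congruent c d.
Proof.
have pos : 0 < period n by rewrite /period; lia.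
case/cls_eq=> [[/negP c4 _] /eqP /c4 //|].
by case=> _ _ [k ->] _; rewrite /congruent; have := multiple_cases k pos; lia.
Qed.

Section OddLabel.

Variable o : nat.
Hypothesis oo : odd_label n xi o.

Lemma src_src g h : src g = src h -> src g != o -> congruent (cA g) (cA h).
Proof.
move=> E go; have [i _ [S [_ _ _ _ [E1 _]]]] := crdP n_gt0 sx g.
have [k _ [T [_ _ _ _ [E2 _]]]] := crdP n_gt0 sx h.
apply: cls_congruent; first by rewrite E1 E2 E.
by have [E3 _] := crd_even n_gt0 sx g oo; apply/eqP; rewrite E3.
Qed.

Lemma tgt_tgt g h : tgt g = tgt h -> tgt g != o -> congruent (cB g) (cB h).
Proof.
move=> E go; have [i _ [S [_ _ _ _ [_ E1]]]] := crdP n_gt0 sx g.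
have [k _ [T [_ _ _ _ [_ E2]]]] := crdP n_gt0 sx h.
apply: cls_congruent; first by rewrite E1 E2 E.
by have [_ E3] := crd_even n_gt0 sx g oo; apply/eqP; rewrite E3.
Qed.

Lemma tgt_src g h : tgt g = src h -> tgt g != o -> congruent (cB g) (cA h).
Proof.
move=> E go; have [i _ [S [_ _ _ _ [_ E1]]]] := crdP n_gt0 sx g.
have [k _ [T [_ _ _ _ [E2 _]]]] := crdP n_gt0 sx h.
apply: cls_congruent; first by rewrite E1 E2 E.
by have [_ E3] := crd_even n_gt0 sx g oo; apply/eqP; rewrite E3.
Qed.

Lemma src_inj_crd g h : cA g = cA h -> src g = src h.
Proof.
move=> E; have [i _ [S [_ _ _ _ [E1 _]]]] := crdP n_gt0 sx g.
have [k _ [T [_ _ _ _ [E2 _]]]] := crdP n_gt0 sx h.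
have [_ sep _ _ _] := sx; have := (src_lt_tgt g, tgt_le g, src_lt_tgt h, tgt_le h).
by case=> -[[l1 l2] l3] l4; apply: sep; rewrite -?E1 -?E2 ?E //; lia.
Qed.

(** The equality covers an exchanged root that degenerates to a point. By [below_joined] both
    exchanged roots of a pair are joined as soon as a sequence lies below the pair. *)
Definition joined a b x y : Prop :=
  x = y \/ exists g, [/\ between w a b g, src g = x & tgt g = y].

(* Otherwise the exchanged root would precede [a] or follow [b] in one of the
   two lexicographic words. *)
Lemma between_box a b : beforeA a b -> joined a b (src a) (tgt b) ->
  [/\ cA a <= cA b, cB a <= cB b
    & forall g, between w a b g -> [/\ cA a <= cA g, cA g <= cA b, cB a <= cB g & cB g <= cB b]].
Proof.
move=> ab H; have per : period n = 2 * full_turn n by rewrite /period /full_turn; lia.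
have [Wa1 Wa2 Wa3] := crd_width n_gt0 sx a oo.
have [Wb1 Wb2 Wb3] := crd_width n_gt0 sx b oo.
have box g : between w a b g -> beforeA a g /\ beforeA g b.
  by move=> /between_lex[+ _]; move: ab; rewrite /beforeA; lia.
have ordB : cB a <= cB b.
  case: (leP (cB a) (cB b)) => // lt_ba; exfalso.
  case: H => [E|[g [ag E1 E2]]].
    have [eo|no] := eqVneq (src a) o.
      have := Wa3 (or_introl eo); rewrite E in eo; have := Wb3 (or_intror eo).
      by move: ab; rewrite /beforeA; lia.
    rewrite E in no; have := tgt_src (esym E) no.
    by move: ab; rewrite /congruent /beforeA; lia.
  have [Wg1 Wg2 Wg3] := crd_width n_gt0 sx g oo.
  have [b1 b2] := box g ag; have [_ b3] := between_lex ag.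
  have [eo|no] := eqVneq (src g) o.
    have := Wg3 (or_introl eo); rewrite E1 in eo; have := Wa3 (or_introl eo).
    by move: b1 b2 b3 ab; rewrite /beforeA /beforeB; lia.
  have := src_src E1 no.
  by move: b1 b2 b3 ab; rewrite /beforeA /beforeB /congruent; lia.
split=> //; first by move: ab; rewrite /beforeA; lia.
move=> g ag; have [b1 b2] := box g ag; have [_ b3] := between_lex ag.
have [c1 c2] : cA a <= cA g /\ cA g <= cA b by move: b1 b2; rewrite /beforeA; lia.
have [c3 c4] : cB a <= cB g /\ cB g <= cB b by move: b3; rewrite /beforeB; lia.
by [].
Qed.

Lemma between_before a b g : between w a b g -> beforeA a b \/ beforeA b a.
Proof. by case/between_lex=> + _; rewrite /beforeA; lia. Qed.

(* A point that is reached and left inside the interval, and is not a common end of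
   [a] and [b], lies inside the convex hull of the ends of [a] and [b]; the vertices
   being in convex position, it is the center. *)
Lemma no_transit_before a b g1 g2 : beforeA a b ->
  between w a b g1 -> between w a b g2 -> tgt g1 = src g2 -> src g2 != o ->
  joined a b (src a) (tgt b) -> joined a b (src b) (tgt a) ->
  (src g2 = src b /\ src b = tgt a) \/ (src g2 = src a /\ src a = tgt b).
Proof.
move=> ab bg1 bg2 E no Jad Jcb.
have per : period n = 2 * full_turn n by rewrite /period /full_turn; lia.
have [le1 le2 box] := between_box ab Jad.
have [Wa1 Wa2 Wa3] := crd_width n_gt0 sx a oo.
have [Wb1 Wb2 Wb3] := crd_width n_gt0 sx b oo.
have turn : cB a > cA b \/ cA a + period n > cB b.
  by have := @one_turn _ n_gt0 _ _ sx a b; lia.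
have [p1 p2 p3 p4] := box _ bg1; have [q1 q2 q3 q4] := box _ bg2.
have [Wg1 Wg2 _] := crd_width n_gt0 sx g1 oo; have [Wh1 Wh2 _] := crd_width n_gt0 sx g2 oo.
have cong : congruent (cB g1) (cA g2) by apply: tgt_src => //; rewrite E.
(* In the first case cB a is at most cA b, and a root from src b to tgt a inside the interval would
   have width at most 0; in the second, a root from src a to tgt b would have width at least
   [period]. So the exchanged root is degenerate. *)
have {cong} [k0|k1] : cB g1 = cA g2 \/ cB g1 = cA g2 + period n.
  by move: cong; rewrite /congruent; lia.
- left; case: Jcb => [Ey|[h [bh E1 E2]]].
    have [eo|yo] := eqVneq (src b) o.
      have := Wb3 (or_introl eo); rewrite Ey in eo; have := Wa3 (or_intror eo); lia.
    rewrite Ey in yo; have := tgt_src (esym Ey) yo; rewrite /congruent => cong.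
    by split=> //; apply: src_inj_crd; lia.
  exfalso; have [h1 h2 h3 h4] := box _ bh.
  have [Wk1 Wk2 Wk3] := crd_width n_gt0 sx h oo.
  have [eo|so] := eqVneq (src h) o.
    have := Wk3 (or_introl eo); have ebo := eo; rewrite E1 in ebo.
    have := Wb3 (or_introl ebo); have to : tgt h != o by have := src_lt_tgt h; lia.
    by have := tgt_tgt E2 to; rewrite /congruent; lia.
  have eA : cA h = cA b by have := src_src E1 so; rewrite /congruent; lia.
  have [eo|to] := eqVneq (tgt h) o.
    have := Wk3 (or_intror eo); have eao := eo; rewrite E2 in eao.
    by have := Wa3 (or_intror eao); lia.
  have eB : cB h = cB a by have := tgt_tgt E2 to; rewrite /congruent; lia.
  by lia.
- right; case: Jad => [Ey|[h [bh E1 E2]]].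
    have [eo|yo] := eqVneq (src a) o.
      have := Wa3 (or_introl eo); rewrite Ey in eo; have := Wb3 (or_intror eo); lia.
    rewrite Ey in yo; have := tgt_src (esym Ey) yo; rewrite /congruent => cong.
    by split=> //; apply: src_inj_crd; lia.
  exfalso; have [h1 h2 h3 h4] := box _ bh.
  have [Wk1 Wk2 Wk3] := crd_width n_gt0 sx h oo.
  have [eo|so] := eqVneq (src h) o.
    have := Wk3 (or_introl eo); have eao := eo; rewrite E1 in eao.
    have := Wa3 (or_introl eao); have to : tgt h != o by have := src_lt_tgt h; lia.
    by have := tgt_tgt E2 to; rewrite /congruent; lia.
  have eA : cA h = cA a by have := src_src E1 so; rewrite /congruent; lia.
  have [eo|to] := eqVneq (tgt h) o.
    have := Wk3 (or_intror eo); have ebo := eo; rewrite E2 in ebo.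
    by have := Wb3 (or_intror ebo); lia.
  have eB : cB h = cB b by have := tgt_tgt E2 to; rewrite /congruent; lia.
  by lia.
Qed.

Lemma joinedC a b x y : joined a b x y -> joined b a x y.
Proof. by case=> [->|[g [/betweenC ? ? ?]]]; [left|right; exists g]. Qed.

Lemma no_transit a b g1 g2 :
  between w a b g1 -> between w a b g2 -> tgt g1 = src g2 -> src g2 != o ->
  joined a b (src a) (tgt b) -> joined a b (src b) (tgt a) ->
  (src g2 = src b /\ src b = tgt a) \/ (src g2 = src a /\ src a = tgt b).
Proof.
move=> b1 b2 E no J1 J2; have [ab|ba] := between_before b1.
  exact: no_transit_before b1 b2 E no J1 J2.
have := no_transit_before ba (betweenC b1) (betweenC b2) E no (joinedC J2) (joinedC J1).
by case; [right|left].
Qed.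

(* The center has the label n or n + 1, and the simple root (n, n+1) is its first or
   its last crossing. *)
Lemma middle_extremal a b g : src g = n -> tgt g = n.+1 ->
  src a != o -> tgt a != o -> src b != o -> tgt b != o ->
  cA a <= cA g -> cB a <= cB g -> cA g <= cA b -> cB g <= cB b -> False.
Proof.
move=> Eg1 Eg2 ao1 ao2 bo1 bo2 le1 le2 le3 le4.
have [hx _ _ _ _] := sx; have [_ G2 G3] := hx; have [on _ _] := oo.
have [|S [EA EB par lo hi]] := @crd_middle _ n_gt0 _ _ sx o g oo; first by lia.
have wn : width n n = (n.*2.+1)%:Z by rewrite /width ltnn eqxx.
have wp : width n n.-1 = 2 * n%:Z by rewrite /width; repeat case: ifP; lia.
have ws : width n n.+1 = 2 * n.+1%:Z by rewrite /width; repeat case: ifP; lia.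
have G2n : ((xi n.-1 - 2 * n%:Z) %% 4)%Z = 0 by rewrite -wp; apply: G2; lia.
have G2m : ((xi n.+1 - 2 * n.+1%:Z) %% 4)%Z = 0 by rewrite -ws; apply: G2; lia.
have ln : line n xi n = if xi n < xi n.-1 then xi n - width n n else xi n.-1 + width n n.-1.
  by rewrite /line; repeat case: eqP; lia.
have ln1 : line n xi n.+1 = if xi n.+1 < xi n then xi n.+1 - width n n.+1 else xi n + width n n.
  by rewrite /line /=; repeat case: eqP; lia.
have even h : src h != o -> tgt h != o -> exists i, exists T,
    [/\ (i <= n.*2)%N, i != n, cA h = T - width n i, cB h = T + width n i
      & xi i <= T /\ T + 4 <= xi (n.*2 - i)%N + full_turn n].
  move=> ho1 ho2; have [i i_le [T [EA' EB' gr [l1 l2] _]]] := crdP n_gt0 sx h.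
  have [E1 E2] := crd_even n_gt0 sx h oo; rewrite ho1 in E1; rewrite ho2 in E2.
  have ni : i != n.
    by apply: contraTneq E1 => ni; move: E2; rewrite EA' EB' ni wn; lia.
  by exists i, T; split=> //; move: l2; rewrite /jump (negPf ni).
have slope i k := @height_slope n n_gt0 xi i k hx.
(* If g is the first letter n, the slope bound makes every crossing off the center too late in one
   coordinate to precede g. The next claim is the dual one for the last letter n. *)
have first_case : S = xi n -> xi n < xi n.-1 -> xi n < xi n.+1 -> False.
  move=> ES lt1 lt2; have [i [T [i_le ni EA' EB' [l1 l2]]]] := even a ao1 ao2.
  have [ii|ii] := ltnP i n.
    have wi : width n i = 2 * i.+1%:Z by rewrite /width ii.
    by have := slope i n.-1; rewrite wp wi; lia.
  have wi : width n i = 2 * i%:Z by rewrite /width; repeat case: ifP; lia.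
  by have := slope i n.+1; rewrite ws wi; lia.
have last_case : S = xi n + full_turn n - 2 -> xi n.-1 <= xi n + 1 -> xi n.+1 <= xi n + 1 -> False.
  move=> ES lt1 lt2; have [i [T [i_le ni EA' EB' [l1 l2]]]] := even b bo1 bo2.
  have wd := width_dual i_le; rewrite /full_turn in l2 ES.
  have [ii|ii] := ltnP i n.
    have wi : width n i = 2 * i.+1%:Z by rewrite /width ii.
    by have := slope n.+1 (n.*2 - i)%N; rewrite ws wd wi; lia.
  have wi : width n i = 2 * i%:Z by rewrite /width; repeat case: ifP; lia.
  have := slope n.-1 (n.*2 - i)%N; rewrite wp wd wi => sl.
  by clear - sl lt1 lt2 l1 l2 EA' EB' wi wn wp EA EB ES le3 le4 i_le ni ii n_gt0; lia.
have [i i_le [T [_ _ _ _ [cl1 cl2]]]] := crdP n_gt0 sx g.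
rewrite Eg1 Eg2 in cl1 cl2.
have clA : ((cA g %% 4)%Z = 0 -> congruent (cA g) (line n xi n)) by exact: cls_congruent.
have clB : ((cB g %% 4)%Z = 0 -> congruent (cB g) (line n xi n.+1)) by exact: cls_congruent.
have per : period n = 4 * (n.*2.+1)%:Z by [].
have tur : full_turn n = 2 * (n.*2.+1)%:Z by [].
have [e1 e2] := crd_even n_gt0 sx g oo; rewrite Eg1 Eg2 in e1 e2.
have [_ odd_o even_p] := oo.
have on1 : (line n xi n %% 4)%Z != 0 -> o = n.
  by move=> H; apply/eqP; apply: contraR H; rewrite eq_sym => /even_p->; lia.
have on2 : (line n xi n.+1 %% 4)%Z != 0 -> o = n.+1.
  by move=> H; apply/eqP; apply: contraR H; rewrite eq_sym => /even_p->; lia.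
rewrite ln ln1 wn wp ws in on1 on2 clA clB.
(* The end of g off the center fixes S modulo [period], and S ranges over a shorter window. In the
   patterns 1 and 3 this makes g the first letter n, in 2 and 4 the last. *)
case: G3 => -[E1 E2]; rewrite {}E1 {}E2 in G2n G2m on1 on2 clA clB first_case last_case.
- have o2 : o = n.+1 by apply: on2; rewrite ifF; lia.
  have {}clA : congruent (cA g) (xi n - (n.*2.+1)%:Z).
    by rewrite ifT in clA; [apply: clA; apply/eqP; rewrite e1 o2|]; lia.
  by apply: first_case; [move: clA; rewrite EA /congruent per tur in hi *|..]; lia.
- have o1 : o = n by apply: on1; rewrite ifT; lia.
  have {}clB : congruent (cB g) (xi n - 1 - 2 * n.+1%:Z).
    by rewrite ifT in clB; [apply: clB; apply/eqP; rewrite e2 o1|]; lia.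
  by apply: last_case; [move: clB; rewrite EB /congruent per tur in hi *|..]; lia.
- have o1 : o = n by apply: on1; rewrite ifT; lia.
  have {}clB : congruent (cB g) (xi n + (n.*2.+1)%:Z).
    by rewrite ifF in clB; [apply: clB; apply/eqP; rewrite e2 o1|]; lia.
  by apply: first_case; [move: clB; rewrite EB /congruent per tur in hi *|..]; lia.
- have o2 : o = n.+1 by apply: on2; rewrite ifF; lia.
  have {}clA : congruent (cA g) (xi n - 1 + 2 * n%:Z).
    by rewrite ifF in clA; [apply: clA; apply/eqP; rewrite e1 o2|]; lia.
  by apply: last_case; [move: clA; rewrite EA /congruent per tur in hi *|..]; lia.
Qed.

Lemma middle_not_between a b g : src g = n -> tgt g = n.+1 ->
  src a != o -> tgt a != o -> src b != o -> tgt b != o ->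
  joined a b (src a) (tgt b) -> joined a b (src b) (tgt a) -> ~ between w a b g.
Proof.
move=> Eg1 Eg2 a1 a2 b1 b2 J1 J2 bg; have [ab|ba] := between_before bg.
  by have [_ _ /(_ g bg)[*]] := between_box ab J1; exact: (@middle_extremal a b g).
have [_ _ /(_ g (betweenC bg))[*]] := between_box ba (joinedC J2).
exact: (@middle_extremal b a g).
Qed.

End OddLabel.

End Sweep.

End Intervals.

(** * Weights as flows *)

Section Flow.

Import Order.TTheory GRing.Theory Num.Theory.
Local Open Scope ring_scope.

Variable n : nat.
Implicit Types (x y z : nat) (a b g h : posroot n) (m : msequence n).

Lemma gap_sum (r : nat -> int) N x : (x <= N)%N ->
  \sum_(h < N) (x <= h)%N%:Z * (r h - r h.+1) = r x - r N.
Proof.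
elim: N => [|N IH]; first by rewrite leqn0 => /eqP->; rewrite big_ord0 subrr.
rewrite leq_eqVlt => /orP[/eqP->|le_xN].
  by rewrite subrr big1 // => h _; rewrite leqNgt ltn_ord mul0r.
by rewrite big_ord_recr /= IH // (_ : (x <= N)%N = true) // mul1r addrA subrK.
Qed.

(** The pairing of the weight with a test function r on labels, under which e_x - e_y becomes r x -
    r y. Different choices of r give the conservation law, positivity and reachability. *)
Definition flux (r : nat -> int) m : int := \sum_g (r (src g) - r (tgt g)) *+ m g.

Lemma wt_flux r m : flux r m = \sum_h wt m 0 h * (r h - r h.+1).
Proof.
under [RHS]eq_bigr => h _ do rewrite /wt summxE mulr_suml.
rewrite exchange_big; apply: eq_bigr => g _ /=.
under eq_bigr => h _ do rewrite mulmxnE mulrnAl.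
rewrite sumrMnl; congr (_ *+ _); rewrite root_gap.
under eq_bigr => h _ do rewrite mxE mulrBl.
have := (src_lt_tgt g, tgt_le g) => -[l1 l2].
by rewrite sumrB !gap_sum; lia.
Qed.

Lemma flux_eq r m m' : wt m = wt m' -> flux r m = flux r m'.
Proof. by rewrite !wt_flux => ->. Qed.

Lemma sum_delta (V : nmodType) (f : posroot n -> V) a : \sum_g f g *+ (g == a) = f a.
Proof. by rewrite (bigD1 a) //= eqxx big1 ?addr0 // => g /negPf->. Qed.

Lemma sum_pair (V : nmodType) (f : posroot n -> V) a b :
  \sum_g f g *+ pair_seq a b g = f a + f b.
Proof.
by under eq_bigr => g _ do rewrite ffunE mulrnDr; rewrite big_split /= !sum_delta.
Qed.

Lemma wt_pair a b : wt (pair_seq a b) = root a + root b.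
Proof. exact: sum_pair. Qed.

Lemma wt_single g : wt (single g) = root g.
Proof. by rewrite /wt; under eq_bigr => h _ do rewrite ffunE; exact: sum_delta. Qed.

Lemma pair_seqC a b : pair_seq a b = pair_seq b a.
Proof. by apply/ffunP => g; rewrite !ffunE addnC. Qed.

Definition outflow m x : nat := (\sum_(g | src g == x) m g)%N.
Definition inflow m x : nat := (\sum_(g | tgt g == x) m g)%N.

Lemma flux_at m x : flux (fun y => (y == x)%:Z) m = (outflow m x)%:Z - (inflow m x)%:Z.
Proof.
have cast (P : pred (posroot n)) : \sum_g (P g)%:Z *+ m g = (\sum_(g | P g) m g)%N%:Z.
  rewrite (big_morph Posz PoszD (erefl _)) [RHS]big_mkcond; apply: eq_bigr => g _.
  by case: (P g); rewrite ?mul0rn // natz.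
rewrite /flux; under eq_bigr => g _ do rewrite mulrnBl.
by rewrite sumrB !cast.
Qed.

(** Kirchhoff's law at the label x, obtained from the indicator function of x. *)
Lemma flow m a b x : wt m = wt (pair_seq a b) ->
  (outflow m x + (tgt a == x) + (tgt b == x) = inflow m x + (src a == x) + (src b == x))%N.
Proof.
move=> E; have := flux_at m x; rewrite (flux_eq _ E) /flux sum_pair.
by lia.
Qed.

Lemma outflow_pos m g : m g != 0%N -> (0 < outflow m (src g))%N.
Proof. by move=> mg; rewrite /outflow (bigD1 g) //= addn_gt0 lt0n mg. Qed.

Lemma inflow_pos m g : m g != 0%N -> (0 < inflow m (tgt g))%N.
Proof. by move=> mg; rewrite /inflow (bigD1 g) //= addn_gt0 lt0n mg. Qed.

Lemma outflow_ex m x : (0 < outflow m x)%N -> exists2 g, m g != 0%N & src g = x.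
Proof.
rewrite lt0n sum_nat_eq0 negb_forall => /existsP[g].
by rewrite negb_imply => /andP[/eqP E mg]; exists g.
Qed.

Lemma inflow_ex m x : (0 < inflow m x)%N -> exists2 g, m g != 0%N & tgt g = x.
Proof.
rewrite lt0n sum_nat_eq0 negb_forall => /existsP[g].
by rewrite negb_imply => /andP[/eqP E mg]; exists g.
Qed.

Lemma outflow_one m g h : outflow m (src g) = 1%N -> m g != 0%N -> src h = src g ->
  m h = (h == g).
Proof.
rewrite /outflow (bigD1 g) //= => E mg Eh.
have [->|hg] := eqVneq h g; first by move: E mg; lia.
by move: E mg; rewrite (bigD1 h) /=; [lia|rewrite Eh eqxx hg].
Qed.

Lemma inflow_one m g h : inflow m (tgt g) = 1%N -> m g != 0%N -> tgt h = tgt g ->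
  m h = (h == g).
Proof.
rewrite /inflow (bigD1 g) //= => E mg Eh.
have [->|hg] := eqVneq h g; first by move: E mg; lia.
by move: E mg; rewrite (bigD1 h) /=; [lia|rewrite Eh eqxx hg].
Qed.

(** The test function -y gives each root its positive height, so a nonnegative combination of roots
    with flux zero is trivial. *)
Lemma wt_dominated m m' g : wt m = wt m' -> (forall h, m h <= m' h)%N -> m g = m' g.
Proof.
move=> E le_m; pose r y : int := - y%:Z.
have := flux_eq r E; rewrite /flux => Ef; apply/eqP.
have pos h : 0 < r (src h) - r (tgt h) by have := src_lt_tgt h; rewrite /r; lia.
have : \sum_h (r (src h) - r (tgt h)) *+ (m' h - m h)%N = 0.
  under eq_bigr => h _ do rewrite mulrnBr //.
  by rewrite sumrB -Ef subrr.
move/eqP; rewrite psumr_eq0; last by move=> h _; rewrite mulrn_wge0 ?ltW.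
move/allP => /(_ g); rewrite mem_index_enum => /(_ isT); rewrite implyTb mulrn_eq0.
by have := le_m g; have := pos g; case: eqP; lia.
Qed.

(* The set of labels reachable from the source of [a] along [Q] has no outgoing
   flow, so the target of [b] belongs to it. *)
Lemma reach (Q : posroot n -> Prop) m a b :
  (forall g1 g2 g3, tgt g1 = src g2 -> src g3 = src g1 -> tgt g3 = tgt g2 ->
     Q g1 -> Q g2 -> Q g3) ->
  ~ Q a -> (forall g, m g != 0%N -> Q g) -> wt m = wt (pair_seq a b) ->
  src a = tgt b \/ exists g, [/\ Q g, src g = src a & tgt g = tgt b].
Proof.
move=> conv nQa supp E.
pose R y := y = src a \/ exists g, [/\ Q g, src g = src a & tgt g = y].
pose r y : int := if `[< R y >] then 1 else 0.
have := flux_eq r E; rewrite /flux sum_pair => Ef.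
have le0 : \sum_g (r (src g) - r (tgt g)) *+ m g <= 0.
  apply: sumr_le0 => g _; have [->|mg] := eqVneq (m g) 0%N; first by rewrite mulr0n.
  rewrite pmulrn_lle0 ?lt0n // subr_le0 /r.
  case: asboolP => [Rs|_]; last by case: ifP.
  rewrite ifT //; apply/asboolP; right; case: Rs => [Es|[g1 [Q1 E1 E2]]].
    by exists g; split=> //; exact: supp.
  have lt1 := src_lt_tgt g1; have lt2 := src_lt_tgt g.
  have [||g3 E3 E4] := @ends_ex n (src a) (tgt g); [by lia|exact: tgt_le|].
  by exists g3; split=> //; apply: (conv g1 g g3) => //; [rewrite E1|exact: supp].
have ra : r (src a) = 1 by rewrite /r ifT //; apply/asboolP; left.
have rta : r (tgt a) = 0.
  rewrite /r ifF //; apply/asboolP => -[E1|[g [Qg E1 E2]]].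
    by have := src_lt_tgt a; lia.
  by apply: nQa; rewrite (_ : a = g) //; apply: ends_inj; rewrite /ends E1 E2.
have rb : 0 <= r (src b) by rewrite /r; case: ifP.
have : r (tgt b) != 0 by lia.
by rewrite /r; case: asboolP => // -[->|[g ?]] _; [left|right; exists g].
Qed.

End Flow.

(** * Sequences below a pair *)

Section Below.

Variables (n : nat) (w : word n).
Implicit Types (x y z : nat) (a b g h : posroot n) (m : msequence n) (j : word n).

Lemma between_irrefl a b : ~ between w a b a.
Proof. by move=> /(_ w (comm_refl w)); lia. Qed.

Lemma blt_irrefl m : ~ prec w m m.
Proof. by move=> /(_ w (comm_refl w)) [k [s [_ _]]]; rewrite ltnn. Qed.

Lemma root_eq g h : src g = src h -> tgt g = tgt h -> g = h.
Proof. by move=> E1 E2; apply: ends_inj; rewrite /ends E1 E2. Qed.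

Lemma pair_pos a b g : pair_seq a b g != 0 -> g = a \/ g = b.
Proof.
rewrite ffunE; case: (g =P a) => [->|_]; first by left.
by case: (g =P b) => [->|//]; right.
Qed.

(* For sequences of the weight of the pair this is [prec], see [prec_below]
   and [below_prec]. *)
Definition below a b m : Prop :=
  wt m = wt (pair_seq a b) /\ forall g, m g != 0 -> between w a b g.

Lemma belowC a b m : below a b m -> below b a m.
Proof. by case=> E H; split=> [|g /H/betweenC//]; rewrite pair_seqC. Qed.

Lemma below_not_ends a b m g : below a b m -> m g != 0 ->
  ~ (src g = src a /\ tgt g = tgt a) /\ ~ (src g = src b /\ tgt g = tgt b).
Proof.
move=> [_ H] mg; split=> -[E1 E2].
  by apply: (@between_irrefl a b); rewrite -{2}(root_eq E1 E2); exact: H.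
by apply: (@between_irrefl b a); apply: betweenC; rewrite -{2}(root_eq E1 E2); exact: H.
Qed.

Lemma source_cases a b m g : below a b m -> m g != 0 ->
  (forall h, m h != 0 -> tgt h <> src g) -> src g = src a \/ src g = src b.
Proof.
move=> [E _] mg no; have := flow (src g) E; have := outflow_pos mg.
have : inflow m (src g) = 0.
  by apply/eqP; rewrite -leqn0 leqNgt; apply/negP => /inflow_ex[h mh]; exact: no.
by do 4 case: eqP; lia.
Qed.

Lemma target_cases a b m g : below a b m -> m g != 0 ->
  (forall h, m h != 0 -> src h <> tgt g) -> tgt g = tgt a \/ tgt g = tgt b.
Proof.
move=> [E _] mg no; have := flow (tgt g) E; have := inflow_pos mg.
have : outflow m (tgt g) = 0.
  by apply/eqP; rewrite -leqn0 leqNgt; apply/negP => /outflow_ex[h mh]; exact: no.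
by do 4 case: eqP; lia.
Qed.

(** Below a pair this is the combinatorial form of [simple_seq], by [transit_free_simple] and
    [simple_transit_free]. *)
Definition transit_free m : Prop :=
  forall g1 g2, m g1 != 0 -> m g2 != 0 -> tgt g1 <> src g2.

(* If one of the two exchanged roots degenerates to (x, x) its term is 0, so this
   is then a single root. *)
Definition exchange a b : msequence n := [ffun g =>
  ((src g == src a) && (tgt g == tgt b)) + ((src g == src b) && (tgt g == tgt a))].

End Below.

(** * The order on sequences in terms of intervals *)

Section Sequences.

Variables (n : nat) (n_gt0 : (0 < n)%N) (xi : nat -> int) (w : word n).
Hypothesis sx : sweep xi w.
Implicit Types (x y z : nat) (a b g h : posroot n) (m : msequence n) (j : word n).

Lemma value_rank j m g : comm_equiv w j -> value m (beta j (rank j g)) = m g.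
Proof.
by move=> wj; rewrite (beta_rank n_gt0 (sweep_comm n_gt0 wj sx)) value_root.
Qed.

Lemma bltP j m' m : comm_equiv w j -> blt j m' m <-> exists a b,
  [/\ rank j a <= rank j b,
      forall g, (rank j g < rank j a) || (rank j b < rank j g) -> m' g = m g,
      m' a < m a & m' b < m b].
Proof.
move=> wj; have sj := sweep_comm n_gt0 wj sx; split.
  move=> [k [s [/andP[le_ks lt_s] out lt1 lt2]]].
  have [a Ea] := rank_ex n_gt0 sj (leq_ltn_trans le_ks lt_s).
  have [b Eb] := rank_ex n_gt0 sj lt_s; exists a, b.
  rewrite -Ea !(value_rank _ _ wj) in lt1; rewrite -Eb !(value_rank _ _ wj) in lt2.
  split=> //; first by rewrite Ea Eb.
  move=> g; rewrite Ea Eb => /(out _ (rank_lt n_gt0 sj g)).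
  by rewrite !value_rank.
move=> [a [b [le_ab out lt1 lt2]]]; exists (rank j a), (rank j b).
split; rewrite ?value_rank // ?le_ab ?(rank_lt n_gt0 sj) //.
move=> t lt_t; have [g <-] := rank_ex n_gt0 sj lt_t.
by rewrite !value_rank //; exact: out.
Qed.

Lemma rank_injw j : comm_equiv w j -> injective (rank j).
Proof. by move=> wj; exact: (rank_inj n_gt0 (sweep_comm n_gt0 wj sx)). Qed.

Lemma between_convex a b g1 g2 g3 :
  tgt g1 = src g2 -> src g3 = src g1 -> tgt g3 = tgt g2 ->
  between w a b g1 -> between w a b g2 -> between w a b g3.
Proof.
move=> E1 E2 E3 b1 b2 j wj; have sj := sweep_comm n_gt0 wj sx.
by have := (b1 j wj, b2 j wj, rank_convex n_gt0 sj E1 E2 E3) => -[[]]; lia.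
Qed.

Lemma prec_below a b m : a != b ->
  prec w m (pair_seq a b) -> wt m = wt (pair_seq a b) -> below w a b m.
Proof.
move=> ab pr E; split=> // g mg j wj; have [a0 [b0 [le_r out lt1 lt2]]] := (bltP _ _ wj).1 (pr j wj).
have inj := rank_injw wj.
have Ha : a0 = a \/ a0 = b by apply: pair_pos; lia.
have Hb : b0 = a \/ b0 = b by apply: pair_pos; lia.
have ma0 : m a0 = 0 by move: lt1; rewrite ffunE; case: Ha => ->; rewrite eqxx ?(negPf ab) 1?eq_sym ?(negPf ab); lia.
have mb0 : m b0 = 0 by move: lt2; rewrite ffunE; case: Hb => ->; rewrite eqxx ?(negPf ab) 1?eq_sym ?(negPf ab); lia.
(* If both witnesses of the order were the same root, m would be dominated by the pair and have the
   same weight, hence be equal to it. *)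
have ab0 : a0 != b0.
  apply/eqP => E0; subst b0.
  have := wt_dominated a0 E; suff H : forall h, m h <= pair_seq a b h by move=> /(_ H); lia.
  move=> h; have [->|ha] := eqVneq h a0; first by lia.
  rewrite out //; have : rank j h != rank j a0 by apply: contra_neq ha => /inj.
  by lia.
have ga : g != a0 by apply: contra_neq mg => ->.
have gb : g != b0 by apply: contra_neq mg => ->.
have ra : rank j g != rank j a0 by apply: contra_neq ga => /inj.
have rb : rank j g != rank j b0 by apply: contra_neq gb => /inj.
have inside : ~~ ((rank j g < rank j a0) || (rank j b0 < rank j g)).
  apply/negP => /out E0; rewrite E0 in mg; move: ga gb ab0.
  by case: (pair_pos mg) Ha Hb => -> [->|->] [->|->]; rewrite ?eqxx.
case: Ha Hb => E1 [E2|E2]; rewrite E1 E2 ?eqxx // in ab0 inside ra rb *; first by lia.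
by lia.
Qed.

Lemma below_prec a b m : a != b -> (forall g, m g != 0 -> between w a b g) ->
  prec w m (pair_seq a b).
Proof.
move=> ab H j wj.
have ma : m a = 0 by apply/eqP; apply: contraT => /H /between_irrefl.
have mb : m b = 0 by apply/eqP; apply: contraT => /H /betweenC /between_irrefl.
have pa : 0 < pair_seq a b a by rewrite ffunE eqxx.
have pb : 0 < pair_seq a b b by rewrite ffunE eqxx addnC.
have out g : g != a -> g != b -> ~ between w a b g -> m g = pair_seq a b g.
  move=> /negPf ga /negPf gb nb; rewrite ffunE ga gb.
  by apply/eqP; apply: contraT => /H.
apply/(bltP _ _ wj); case: (leqP (rank j a) (rank j b)) => le_ab.
  exists a, b; split; rewrite ?ma ?mb // => g og; apply: out.
  - by apply: contraTneq og => ->; lia.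
  - by apply: contraTneq og => ->; lia.
  - by move=> /(_ j wj); lia.
exists b, a; split; rewrite ?ma ?mb // ?(ltnW le_ab) // => g og; apply: out.
- by apply: contraTneq og => ->; lia.
- by apply: contraTneq og => ->; lia.
- by move=> /(_ j wj); lia.
Qed.

(** A root of m1 outside the window of change also belongs to m2; one inside the window lies between
    two roots of m2. *)
Lemma prec_trans_below a b m1 m2 : prec w m1 m2 -> wt m1 = wt m2 -> below w a b m2 -> below w a b m1.
Proof.
move=> pr E [E2 H]; split; first by rewrite E.
move=> g mg j wj; have [a0 [b0 [le_r out lt1 lt2]]] := (bltP _ _ wj).1 (pr j wj).
have Ha : m2 a0 != 0 by lia.
have Hb : m2 b0 != 0 by lia.
have [og|ing] := boolP ((rank j g < rank j a0) || (rank j b0 < rank j g)).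
  by apply: H => //; rewrite -out.
by have := (H _ Ha j wj, H _ Hb j wj) => -[]; lia.
Qed.

Lemma below_joined a b m : below w a b m -> joined w a b (src a) (tgt b).
Proof.
move=> [E H]; have [|||] := @reach n (between w a b) m a b _ _ H E.
- by move=> g1 g2 g3; exact: between_convex.
- exact: between_irrefl.
- by left.
- by right.
Qed.

Lemma below_srcs a b m : below w a b m -> src a != src b.
Proof.
move=> Hm; apply/eqP => E; case: (below_joined Hm) => [E'|[g [bg E1 E2]]].
  by have := src_lt_tgt b; lia.
have gb : g = b by apply: root_eq; rewrite ?E1.
by apply: (@between_irrefl _ w b a); apply: betweenC; rewrite -{2}gb.
Qed.

Lemma below_tgts a b m : below w a b m -> tgt a != tgt b.
Proof.
move=> Hm; apply/eqP => E; case: (below_joined Hm) => [E'|[g [bg E1 E2]]].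
  by have := src_lt_tgt a; lia.
have ga : g = a by apply: root_eq; rewrite ?E2.
by apply: (@between_irrefl _ w a b); rewrite -{2}ga.
Qed.

Lemma lone_edge a b m g : below w a b m -> src g = src a -> src a <> tgt b ->
  (forall h, m h != 0 -> src h = src a -> h = g) ->
  (forall h, m h != 0 -> tgt h <> src a) -> m g = 1.
Proof.
move=> Hm Eg ne only no; have [E _] := Hm; have := flow (src a) E.
have -> : inflow m (src a) = 0.
  by apply/eqP; rewrite -leqn0 leqNgt; apply/negP => /inflow_ex[h mh]; exact: no.
rewrite eqxx; have /eqP := below_srcs Hm; have lt_a := src_lt_tgt a.
move=> nab out1; have {}out1 : outflow m (src a) = 1 by move: out1; do 3 case: eqP; lia.
have [|h mh Eh] := @outflow_ex n m (src a); first by rewrite out1.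
have hg := only h mh Eh; subst h; rewrite -Eg in out1.
by rewrite (outflow_one out1 mh (erefl _)) eqxx.
Qed.

Lemma transit_free_edges a b m g : below w a b m -> transit_free m -> m g != 0 ->
  (src g = src a /\ tgt g = tgt b) \/ (src g = src b /\ tgt g = tgt a).
Proof.
move=> Hm tf mg; have [n1 n2] := below_not_ends Hm mg.
have S : src g = src a \/ src g = src b by apply: (source_cases Hm mg) => h mh; exact: tf.
have T : tgt g = tgt a \/ tgt g = tgt b.
  by apply: (target_cases Hm mg) => h mh E; exact: (tf g h mg mh).
by case: S T => [E1|E1] [E2|E2]; [case: n1|left|right|case: n2].
Qed.

Lemma exchange_value a b m g : below w a b m -> transit_free m ->
  src g = src a -> tgt g = tgt b -> m g = 1.
Proof.
move=> Hm tf E1 E2; apply: (lone_edge Hm E1); first by have := src_lt_tgt g; lia.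
  move=> h mh Eh; apply: root_eq; first by rewrite E1.
  by case: (transit_free_edges Hm tf mh) => -[E3 E4]; [rewrite E2|have /eqP := below_srcs Hm; rewrite -Eh -E3].
move=> h mh Eh.
have [|k mk Ek] := @outflow_ex n m (src a).
  have [E _] := Hm; have := flow (src a) E; rewrite eqxx; have := src_lt_tgt a.
  have := src_lt_tgt g; rewrite E1 E2; do 3 case: eqP; lia.
by apply: (tf h k mh mk); rewrite Eh.
Qed.

Lemma transit_free_exchange a b m : below w a b m -> transit_free m -> m = exchange a b.
Proof.
move=> Hm tf; apply/ffunP => g; rewrite ffunE.
have /eqP nab := below_srcs Hm.
have [/andP[/eqP E1 /eqP E2]|n1] := boolP ((src g == src a) && (tgt g == tgt b)).
  rewrite (exchange_value Hm tf E1 E2) (_ : (src g == src b) = false) //.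
  by apply/eqP; rewrite E1.
have [/andP[/eqP E1 /eqP E2]|n2] := boolP ((src g == src b) && (tgt g == tgt a)).
  by rewrite (exchange_value (belowC Hm) tf E1 E2).
apply/eqP; apply: contraT => /(transit_free_edges Hm tf)[[E1 E2]|[E1 E2]].
  by rewrite E1 E2 !eqxx in n1.
by rewrite E1 E2 !eqxx in n2.
Qed.

(** A sequence below the two exchanged roots would, by exchanging once more, put the root a into
    their interval, although both of them lie strictly between a and b. *)
Lemma transit_free_simple a b m : below w a b m -> transit_free m -> simple_seq w m.
Proof.
move=> Hm tf; right=> g1 g2 g12 m1 m2 [m' [pr E]].
have Hm' := prec_below g12 pr E.
have [_ H] := Hm; have [b1 b2] := (H _ m1 w (comm_refl w), H _ m2 w (comm_refl w)).
have wlog_case h1 h2 : h1 != h2 -> below w h1 h2 m' -> m h1 != 0 -> m h2 != 0 ->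
    src h1 = src a -> tgt h1 = tgt b -> src h2 = src b -> tgt h2 = tgt a -> False.
  move=> h12 Hh mh1 mh2 E1 E2 E3 E4; have [c1 c2] := (H _ mh1 w (comm_refl w), H _ mh2 w (comm_refl w)).
  case: (below_joined Hh) => [E5|[h [bh E5 E6]]].
    by have := src_lt_tgt a; lia.
  have ha : h = a by apply: root_eq; lia.
  by have := bh w (comm_refl w); rewrite ha; lia.
case: (transit_free_edges Hm tf m1) (transit_free_edges Hm tf m2) => -[E1 E2] [] [E3 E4].
- by case/eqP: g12; apply: root_eq; rewrite ?E3 ?E4.
- exact: (wlog_case g1 g2).
- by apply: (wlog_case g2 g1) => //; [rewrite eq_sym|exact: belowC].
- by case/eqP: g12; apply: root_eq; rewrite ?E3 ?E4.
Qed.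

Lemma single_below g1 g2 g3 : tgt g1 = src g2 -> src g3 = src g1 -> tgt g3 = tgt g2 ->
  below w g1 g2 (single g3).
Proof.
move=> E1 E2 E3; split.
  rewrite wt_single wt_pair !root_gap E1 E2 E3; apply/rowP => i; rewrite !mxE.
  by lia.
move=> g; rewrite ffunE; case: (g =P g3) => // -> _ j wj.
have sj := sweep_comm n_gt0 wj sx.
exact: (rank_convex n_gt0 sj E1 E2 E3).
Qed.

Lemma composable_not_simple g1 g2 : tgt g1 = src g2 -> g1 != g2 /\ ~ simple_pair w g1 g2.
Proof.
move=> E; have lt1 := src_lt_tgt g1; have lt2 := src_lt_tgt g2.
have g12 : g1 != g2 by apply: contra_eq_neq E => ->; lia.
have [||g3 E1 E2] := @ends_ex n (src g1) (tgt g2); [by lia|exact: tgt_le|].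
split=> //; apply; have [Ew H] := single_below E E1 E2.
by exists (single g3); split=> //; exact: below_prec.
Qed.

Lemma simple_transit_free m : simple_seq w m -> transit_free m.
Proof.
move=> sm g1 g2 m1 m2 E; have [g12 ns] := composable_not_simple E.
case: sm => [[g Hg]|H]; last exact: ns (H _ _ g12 m1 m2).
by rewrite !Hg in m1 m2; rewrite (eqP m1) (eqP m2) eqxx in g12.
Qed.

End Sequences.

(** * Detours through the center *)

Section Detours.

Variables (n : nat) (n_gt0 : (0 < n)%N) (xi : nat -> int) (w : word n).
Hypothesis sx : sweep xi w.
Variable o : nat.
Hypothesis oo : odd_label n xi o.
Implicit Types (x y z : nat) (a b g h : posroot n) (m : msequence n) (j : word n).

(* A transit at a common end of [a] and [b] would need two further transits, both
   at the center. *)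
Lemma transit_odd_aux a b m g1 g2 : below w a b m -> m g1 != 0 -> m g2 != 0 ->
  tgt g1 = src g2 -> src g2 = src b -> src b = tgt a -> src g2 = o.
Proof.
move=> Hm m1 m2 E Eb Ea; apply/eqP; apply: contraT => /eqP no; exfalso.
have lt1 := src_lt_tgt g1; have lt2 := src_lt_tgt g2.
have Hm' := belowC Hm; have [Ew H] := Hm.
have [J1 J2] := (below_joined n_gt0 sx Hm, joinedC (below_joined n_gt0 sx Hm')).
have trans h1 h2 : m h1 != 0 -> m h2 != 0 -> tgt h1 = src h2 -> src h2 <> tgt a ->
    src h2 <> src a -> src h2 = o.
  move=> k1 k2 Eh ne1 ne2; apply/eqP; apply: contraT => no'.
  by case: (no_transit n_gt0 sx oo (H _ k1) (H _ k2) Eh no' J1 J2) => -[]; lia.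
have [n1 _] := below_not_ends Hm m1; have [_ n2] := below_not_ends Hm m2.
have ne1 : src g1 <> src a by move=> E1; apply: n1; split=> //; lia.
have ne2 : tgt g2 <> tgt b by move=> E2; apply: n2; split=> //; lia.
have o1 : src g1 = o.
  have [|h mh Eh] := @inflow_ex n m (src g1).
    by have := flow (src g1) Ew; have := outflow_pos m1; do 4 case: eqP; lia.
  by apply: (trans h g1) => //; lia.
have [|h mh Eh] := @outflow_ex n m (tgt g2).
  have := flow (tgt g2) Ew; have := inflow_pos m2; have := src_lt_tgt a.
  by case: J1 => [?|[k [_ ? ?]]]; have := src_lt_tgt b; do 4 case: eqP; lia.
have : src h = o; last by lia.
apply: (trans g2 h) => //; first by lia.
by have := src_lt_tgt a; lia.
Qed.

Lemma transit_odd a b m g1 g2 : below w a b m -> m g1 != 0 -> m g2 != 0 ->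
  tgt g1 = src g2 -> src g2 = o.
Proof.
move=> Hm m1 m2 E; apply/eqP; apply: contraT => no; have [_ H] := Hm.
have [J1 J2] := (below_joined n_gt0 sx Hm, joinedC (below_joined n_gt0 sx (belowC Hm))).
case: (no_transit n_gt0 sx oo (H _ m1) (H _ m2) E no J1 J2) => -[E1 E2].
  by rewrite (transit_odd_aux Hm m1 m2 E E1 E2) eqxx in no.
by rewrite (transit_odd_aux (belowC Hm) m1 m2 E E1 E2) eqxx in no.
Qed.

Definition detour_at a b g1 g2 : Prop :=
  [/\ src g1 = src a, tgt g1 = o, src g2 = o & tgt g2 = tgt b].

Lemma transit_shape a b m g1 g2 : below w a b m -> m g1 != 0 -> m g2 != 0 ->
  tgt g1 = src g2 -> detour_at a b g1 g2 \/ detour_at b a g1 g2.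
Proof.
move=> Hm m1 m2 E; have Eo := transit_odd Hm m1 m2 E; have [_ H] := Hm.
have lt1 := src_lt_tgt g1; have lt2 := src_lt_tgt g2.
have S : src g1 = src a \/ src g1 = src b.
  apply: (source_cases Hm m1) => h mh Eh.
  by have := transit_odd Hm mh m1 Eh; lia.
have T : tgt g2 = tgt a \/ tgt g2 = tgt b.
  apply: (target_cases Hm m2) => h mh Eh.
  by have := transit_odd Hm m2 mh (esym Eh); lia.
rewrite /detour_at E Eo.
(* A path from src a to tgt a, or from src b to tgt b, would compose to a or to b, which is not in
   its own open interval. *)
case: S T => [E1|E1] [E2|E2]; [|by left|by right|]; exfalso.
  apply: (@between_irrefl _ w a b).
  exact: (between_convex n_gt0 sx E (esym E1) (esym E2) (H _ m1) (H _ m2)).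
apply: (@between_irrefl _ w b a); apply: betweenC.
exact: (between_convex n_gt0 sx E (esym E1) (esym E2) (H _ m1) (H _ m2)).
Qed.

Section DetourForm.

Variables (a b : posroot n) (m : msequence n) (g1 g2 : posroot n).
Hypotheses (Hm : below w a b m) (b1 : between w a b g1) (b2 : between w a b g2)
  (shape : detour_at a b g1 g2).

Let E1 : src g1 = src a. Proof. by case: shape. Qed.
Let E2 : tgt g1 = o. Proof. by case: shape. Qed.
Let E3 : src g2 = o. Proof. by case: shape. Qed.
Let E4 : tgt g2 = tgt b. Proof. by case: shape. Qed.

(* A root using the center in the opposite way would compose with the detour to
   [a] or to [b]. *)
Lemma detour_exclusive h : between w a b h ->
  ~ (src h = src b /\ tgt h = o) /\ ~ (src h = o /\ tgt h = tgt a).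
Proof.
move=> bh; split=> -[F1 F2].
  apply: (@between_irrefl _ w b a); apply: betweenC.
  by apply: (@between_convex n n_gt0 xi w sx a b h g2 b); rewrite ?F1 ?F2 ?E3 ?E4.
apply: (@between_irrefl _ w a b).
by apply: (@between_convex n n_gt0 xi w sx a b g1 h a); rewrite ?F1 ?F2 ?E1 ?E2.
Qed.

Lemma detour_ends_odd : [/\ src a != o, tgt a != o, src b != o & tgt b != o].
Proof.
have lt1 := src_lt_tgt g1; have lt2 := src_lt_tgt g2.
split; [by lia| | |by lia]; apply/eqP => F.
  apply: (@between_irrefl _ w a b); suff E : a = g1 by rewrite {2}E.
  by apply: root_eq; rewrite ?E1 ?E2.
apply: (@between_irrefl _ w b a); apply: betweenC; suff E : b = g2 by rewrite {2}E.
by apply: root_eq; rewrite ?E3 ?E4.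
Qed.

Lemma detour_edges h : m h != 0 ->
  [\/ h = g1, h = g2, src h = src a /\ tgt h = tgt b | src h = src b /\ tgt h = tgt a].
Proof.
move=> mh; have [_ H] := Hm; have [x1 x2] := detour_exclusive (H _ mh).
have [n1 n2] := below_not_ends Hm mh; have lt_h := src_lt_tgt h.
have S : src h = o \/ src h = src a \/ src h = src b.
  have [->|no] := eqVneq (src h) o; [by left|right].
  apply: (source_cases Hm mh) => k mk Ek.
  by have := transit_odd Hm mk mh Ek; lia.
have T : tgt h = o \/ tgt h = tgt a \/ tgt h = tgt b.
  have [->|no] := eqVneq (tgt h) o; [by left|right].
  apply: (target_cases Hm mh) => k mk Ek.
  by have := transit_odd Hm mh mk (esym Ek); lia.
case: S => [S|[S|S]]; case: T => [T|[T|T]].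
- by lia.
- by case: x2.
- by constructor 2; apply: root_eq; rewrite ?E3 ?E4.
- by constructor 1; apply: root_eq; rewrite ?E1 ?E2.
- by case: n1.
- by constructor 3.
- by case: x1.
- by constructor 4.
- by case: n2.
Qed.

Hypothesis (m1 : m g1 != 0) (m2 : m g2 != 0).

(** One unit of flow leaves src a and one enters tgt b, and the detour uses up both. The other path
    is direct, with no term at all if src b = tgt a. So the detour determines m. *)
Lemma detour_value h : m h = (h == g1) + (h == g2) + ((src h == src b) && (tgt h == tgt a)).
Proof.
have [Ew H] := Hm; have [ao1 ao2 bo1 bo2] := detour_ends_odd.
have lt1 := src_lt_tgt g1; have lt2 := src_lt_tgt g2; have lt_h := src_lt_tgt h.
have lta := src_lt_tgt a; have ltb := src_lt_tgt b.
have sab := below_srcs n_gt0 sx Hm; have tab := below_tgts n_gt0 sx Hm.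
have no_in x : x != o -> forall g k, m g != 0 -> m k != 0 -> tgt g = x -> src k <> x.
  move=> xo g k mg mk Eg Ek; have := transit_odd Hm mg mk.
  by rewrite Eg Ek => /(_ erefl) E; rewrite E eqxx in xo.
have out1 : outflow m (src g1) = 1.
  have := flow (src g1) Ew; rewrite E1 eqxx.
  have -> : inflow m (src a) = 0.
    apply/eqP; rewrite -leqn0 leqNgt; apply/negP => /inflow_ex[g mg Eg].
    exact: (no_in _ ao1 g g1 mg m1 Eg E1).
  by move: sab; do 3 case: eqP; lia.
have in2 : inflow m (tgt g2) = 1.
  have := flow (tgt g2) Ew; rewrite E4 eqxx.
  have -> : outflow m (tgt b) = 0.
    apply/eqP; rewrite -leqn0 leqNgt; apply/negP => /outflow_ex[g mg Eg].
    exact: (no_in _ bo2 g2 g m2 mg E4 Eg).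
  by move: tab; do 3 case: eqP; lia.
have g12 : g1 != g2 by apply: contra_eq_neq E1 => ->; rewrite E3; lia.
have [Eh|h1] := eqVneq h g1.
  rewrite {1}Eh (outflow_one out1 m1 (erefl _)) eqxx Eh (negPf g12).
  by rewrite E1 (negPf sab).
have [Eh|h2] := eqVneq h g2.
  rewrite {1}Eh (inflow_one in2 m2 (erefl _)) eqxx Eh E4.
  by rewrite [tgt b == _]eq_sym (negPf tab) andbF.
have [/andP[/eqP S /eqP T]|n3] := boolP ((src h == src b) && (tgt h == tgt a)).
  apply: (lone_edge n_gt0 sx (belowC Hm) S).
  - by lia.
  - move=> k mk Sk; case: (detour_edges mk) => [F|F|[F1 F2]|[F1 F2]].
    + by rewrite F E1 in Sk; rewrite Sk eqxx in sab.
    + by rewrite F E3 in Sk; rewrite Sk eqxx in bo1.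
    + by rewrite F1 in Sk; rewrite Sk eqxx in sab.
    + by apply: root_eq; rewrite ?S // F2 T.
  - move=> k mk Ek; have [|k' mk' Ek'] := @outflow_ex n m (src b).
      have := flow (src b) Ew; rewrite eqxx.
      by move: S T lt_h; do 3 case: eqP; lia.
    exact: (no_in _ bo1 k k' mk mk' Ek Ek').
apply/eqP; apply: contraT => mh; case: (detour_edges mh) => [F|F|[F1 F2]|[F1 F2]].
- by rewrite F eqxx in h1.
- by rewrite F eqxx in h2.
- have := outflow_one out1 m1 (etrans F1 (esym E1)).
  by rewrite (negPf h1) => E; rewrite E in mh.
- by rewrite F1 F2 !eqxx in n3.
Qed.

End DetourForm.

Lemma not_simple_transit a b m : below w a b m -> ~ simple_seq w m ->
  exists g1 g2, [/\ m g1 != 0, m g2 != 0 & tgt g1 = src g2].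
Proof.
move=> Hm ns; apply: contrapT => H; apply: ns.
apply: (transit_free_simple n_gt0 sx Hm) => g1 g2 m1 m2 E.
by apply: H; exists g1, g2.
Qed.

Lemma not_simple_detour a b m : below w a b m -> ~ simple_seq w m ->
  exists g1 g2, [/\ m g1 != 0, m g2 != 0 & detour_at a b g1 g2 \/ detour_at b a g1 g2].
Proof.
move=> Hm /(not_simple_transit Hm)[g1 [g2 [m1 m2 E]]].
by exists g1, g2; split=> //; exact: (transit_shape Hm m1 m2 E).
Qed.

Lemma not_simple_uniq_aux a b m m' g1 g2 : below w a b m -> below w a b m' ->
  m g1 != 0 -> m g2 != 0 -> detour_at a b g1 g2 -> ~ simple_seq w m' -> m = m'.
Proof.
move=> Hm Hm' m1 m2 sh ns; have [_ H] := Hm; have [_ H'] := Hm'.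
have [h1 [h2 [m1' m2' [sh'|sh']]]] := not_simple_detour Hm' ns.
  have [E1 E2 E3 E4] := sh; have [F1 F2 F3 F4] := sh'.
  have e1 : g1 = h1 by apply: root_eq; rewrite ?E1 ?E2.
  have e2 : g2 = h2 by apply: root_eq; rewrite ?E3 ?E4.
  rewrite -{}e1 in m1' sh'; rewrite -{}e2 in m2' sh'.
  apply/ffunP => h.
  by rewrite (detour_value Hm (H _ m1) (H _ m2) sh) // (detour_value Hm' (H _ m1) (H _ m2) sh').
have [F1 F2 _ _] := sh'.
by have [/(_ (conj F1 F2))] := detour_exclusive (H _ m1) (H _ m2) sh (H' _ m1').
Qed.

Lemma not_simple_uniq a b m m' : below w a b m -> below w a b m' ->
  ~ simple_seq w m -> ~ simple_seq w m' -> m = m'.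
Proof.
move=> Hm Hm' ns ns'; have [g1 [g2 [m1 m2 [sh|sh]]]] := not_simple_detour Hm ns.
  exact: (not_simple_uniq_aux Hm Hm' m1 m2 sh ns').
exact: (not_simple_uniq_aux (belowC Hm) (belowC Hm') m1 m2 sh ns').
Qed.

(** The top of the chain is the pair; two further members would both be the unique non-simple
    sequence below it, against the irreflexivity of [prec]. *)
Lemma chain_bound a b k c : a != b -> nonsimple_chain w (pair_seq a b) k c -> k <= 2.
Proof.
move=> ab [_ top ns le]; case: leqP => // lt_k; exfalso.
pose u := k.-2; pose v := k.-2.-1.
have Eu : u.+1 = k.-1 by rewrite /u; lia.
have Ev : v.+1 = u by rewrite /u /v; lia.
have [|nsu wtu] := ns u; first by lia.
have [|nsv wtv] := ns v; first by lia.
have pru : prec w (c u) (pair_seq a b) by rewrite -top -Eu; apply: le; lia.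
have prv : prec w (c v) (c u) by rewrite -Ev; apply: le; lia.
have Hu := prec_below n_gt0 sx ab pru wtu.
have Hv : below w a b (c v) by apply: (prec_trans_below n_gt0 sx prv _ Hu); rewrite wtv.
by apply: (@blt_irrefl _ w (c u)); rewrite {1}(not_simple_uniq Hu Hv nsu nsv).
Qed.

Lemma gdist_ex a b : a != b -> exists2 d, is_gdist w (pair_seq a b) d & d <= 2.
Proof.
move=> ab; have [sm|ns] := pselect (simple_seq w (pair_seq a b)).
  by exists 0 => //; left.
have [[c Hc]|no] := pselect (exists c, nonsimple_chain w (pair_seq a b) 2 c).
  exists 2 => //; right; split=> //; first by exists c.
  by move=> k c'; exact: chain_bound.
exists 1 => //; right; split=> //.
  exists (fun _ => pair_seq a b); split=> //; by move=> ? ?; lia.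
move=> k c Hc; have := chain_bound ab Hc; rewrite leq_eqVlt => /orP[/eqP E|//].
by case: no; exists c; rewrite -E.
Qed.

Lemma simple_pairC a b : simple_pair w a b -> simple_pair w b a.
Proof. by rewrite /simple_pair pair_seqC. Qed.

Lemma simple_pair_seq a b : a != b -> simple_seq w (pair_seq a b) <-> simple_pair w a b.
Proof.
move=> ab; have pa : pair_seq a b a != 0 by rewrite ffunE eqxx.
have pb : pair_seq a b b != 0 by rewrite ffunE eqxx addnC.
split=> [[[g Hg]|H]|sm]; last first.
- right=> g h gh /pair_pos Pg /pair_pos Ph; move: gh.
  case: Pg Ph => -> [->|->]; rewrite ?eqxx // => _.
  exact: simple_pairC.
- exact: H.
- by rewrite !Hg in pa pb; rewrite (eqP pa) (eqP pb) eqxx in ab.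
Qed.

Lemma exchange_below a b m : below w a b m -> below w a b (exchange a b).
Proof.
move=> Hm; have [E H] := Hm.
have [J1 J2] := (below_joined n_gt0 sx Hm, joinedC (below_joined n_gt0 sx (belowC Hm))).
have part x y : joined w a b x y ->
    (\sum_g root g *+ ((src g == x) && (tgt g == y)) = gap n x y)%R /\
    forall g, (src g == x) && (tgt g == y) -> between w a b g.
  case=> [<-|[g [bg <- <-]]].
    have no g : (src g == x) && (tgt g == x) = false by have := src_lt_tgt g; lia.
    split=> [|g]; last by rewrite no.
    rewrite big1 => [|g _]; last by rewrite no.
    by apply/rowP => i; rewrite !mxE GRing.subrr.
  split=> [|h /andP[/eqP E1 /eqP E2]]; last by rewrite (root_eq E1 E2).
  rewrite -root_gap -(sum_delta (@root n)); exact: eq_bigr.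
have [[S1 B1] [S2 B2]] := (part _ _ J1, part _ _ J2); split.
  rewrite wt_pair /wt; under eq_bigr => g _ do rewrite ffunE GRing.mulrnDr.
  rewrite big_split /= S1 S2 !root_gap; apply/rowP => i; rewrite !mxE.
  by lia.
move=> g; rewrite ffunE; case: (boolP (_ && _)) => [/B1//|_].
by case: (boolP (_ && _)) => [/B2//|_].
Qed.

Lemma exchange_pos a b g : exchange a b g != 0 ->
  (src g = src a /\ tgt g = tgt b) \/ (src g = src b /\ tgt g = tgt a).
Proof.
rewrite ffunE addn_eq0 negb_and => /orP[]; rewrite eqb0 negbK => /andP[/eqP ? /eqP ?].
  by left.
by right.
Qed.

Lemma exchange_transit_free a b : transit_free (exchange a b).
Proof.
move=> g1 g2 /exchange_pos c1 /exchange_pos c2 E.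
by have := (src_lt_tgt a, src_lt_tgt b, src_lt_tgt g1, src_lt_tgt g2) => -[[[]]]; lia.
Qed.

Lemma soc_ex_uniq a b : a != b -> exists! s, is_soc w (pair_seq a b) s.
Proof.
move=> ab; have [sm|ns] := pselect (simple_pair w a b).
  exists (pair_seq a b); split.
    by split=> //; [exact/simple_pair_seq|left].
  move=> s [_ E [//|pr]]; case: sm; by exists s.
have [m [pr E]] : exists m, prec w m (pair_seq a b) /\ wt m = wt (pair_seq a b).
  exact: contrapT.
have Hm := prec_below n_gt0 sx ab pr E.
have Hx := exchange_below Hm; have tf := @exchange_transit_free a b.
exists (exchange a b); split.
  have [Ex bx] := Hx; split=> //; first exact: (transit_free_simple n_gt0 sx Hx).
  by right; exact: (below_prec n_gt0 sx ab).
move=> s [ss Es [Ep|prs]].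
  by rewrite Ep in ss; case: ns; exact/simple_pair_seq.
have Hs := prec_below n_gt0 sx ab prs Es.
by rewrite (transit_free_exchange n_gt0 sx Hs (simple_transit_free n_gt0 sx ss)).
Qed.

(** * Folded multiplicities and rds *)

Lemma folded_mult_le g : folded_mult g <= 2.
Proof.
apply/bigmax_leqP => i _; apply: leq_trans (_ : #|[set i; dual i]| <= 2).
  by rewrite -sum1_card; apply: leq_sum => k _; rewrite /coef leq_b1.
by rewrite cards2; case: (_ != _).
Qed.

Lemma folded_mult_wide g : src g < n -> n.+1 < tgt g -> folded_mult g = 2.
Proof.
move=> lt_s lt_t; apply/eqP; rewrite eqn_leq folded_mult_le /=.
(* The orbit {n - 1, n + 1} of residues, which is {n, n + 2} when counted from 1. *)
have lt_n : n.-1 < n.*2.+1 by lia.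
pose i : index n := Ordinal lt_n.
have vd : (dual i : nat) = n.+1 by rewrite /= ; lia.
apply: leq_trans (leq_bigmax i); rewrite big_setU1 ?inE; last first.
  by apply/eqP => E; have := congr1 (@nat_of_ord _) E; rewrite vd /=; lia.
rewrite big_set1 /coef vd /=.
have l1 : (sval g).1 < n := lt_s; have l2 : n.+1 < (sval g).2.+1 := lt_t.
by lia.
Qed.

(** Comparing ends label by label, two roots add up to a root only if one starts where the other
    stops. *)
Lemma pair_above_ends g a b : pair_above w g a b ->
  [/\ tgt a = src b, src g = src a & tgt g = tgt b] \/
  [/\ tgt b = src a, src g = src b & tgt g = tgt a].
Proof.
case=> ab _; rewrite -wt_single => E.
have F x : (tgt a == x) + (tgt b == x) + (src g == x) = (src a == x) + (src b == x) + (tgt g == x).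
  have := flow x (esym E).
  have out : outflow (single g) x = (src g == x).
    rewrite /outflow; have [<-|ne] := eqVneq (src g) x.
      rewrite (bigD1 g) //= ffunE eqxx big1 // => h /andP[_ /negPf hg].
      by rewrite ffunE hg.
    rewrite big1 // => h /eqP Eh; rewrite ffunE.
    by case: (h =P g) => // hg; rewrite -Eh hg eqxx in ne.
  have inn : inflow (single g) x = (tgt g == x).
    rewrite /inflow; have [<-|ne] := eqVneq (tgt g) x.
      rewrite (bigD1 g) //= ffunE eqxx big1 // => h /andP[_ /negPf hg].
      by rewrite ffunE hg.
    rewrite big1 // => h /eqP Eh; rewrite ffunE.
    by case: (h =P g) => // hg; rewrite -Eh hg eqxx in ne.
  by rewrite out inn; lia.
have lta := src_lt_tgt a; have ltb := src_lt_tgt b; have ltg := src_lt_tgt g.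
have [Eab|nab] := eqVneq (tgt a) (src b).
  left; split=> //.
    by have := F (src a); rewrite eqxx; do 5 case: eqP; lia.
  by have := F (tgt b); rewrite eqxx; do 5 case: eqP; lia.
have [Eba|nba] := eqVneq (tgt b) (src a).
  right; split=> //.
    by have := F (src b); rewrite eqxx; do 5 case: eqP; lia.
  by have := F (tgt a); rewrite eqxx; do 5 case: eqP; lia.
exfalso; have := F (src a); have := F (src b); rewrite !eqxx.
by move: nab nba; do 8 case: eqP; lia.
Qed.

(** Splitting off the first simple root gives a pair, so the maximum defining rds is over a nonempty
    set. *)
Lemma pair_above_ex g : ~ is_simple_root g -> exists a b, pair_above w g a b.
Proof.
move=> ns; have lt_g := src_lt_tgt g; have le_g := tgt_le g.
have wide : (src g).+1 < tgt g.
  rewrite ltn_neqAle lt_g andbT; apply/negP => /eqP E; case: ns.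
  by exists (val g).1; rewrite root_gap alpha_gap -E.
have [||a a1 a2] := @ends_ex n (src g) (src g).+1; [by lia|by lia|].
have [|b b1 b2] := @ends_ex n (src g).+1 (tgt g) wide; first by lia.
have [|||E H] := @single_below n n_gt0 xi w sx a b g; rewrite ?a2 //.
have ab : a != b by apply: contra_eq_neq a1 => ->; rewrite b1; lia.
exists a, b; split=> //; first exact: (below_prec n_gt0 sx ab).
by rewrite -E wt_single.
Qed.

Lemma rds_ex g : ~ is_simple_root g -> exists2 d, is_rds w g d & d <= 2.
Proof.
move=> /pair_above_ex[a0 [b0 P0]].
pose attained d := exists a b, pair_above w g a b /\ is_gdist w (pair_seq a b) d.
have build d : d <= 2 -> attained d -> (forall e, attained e -> e <= 2 -> e <= d) ->
    exists2 d, is_rds w g d & d <= 2.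
  move=> d2 att top; exists d => //; split=> // a b P.
  have [ab _ _] := P; have [e He e2] := gdist_ex ab; exists e => //.
  by apply: top => //; exists a, b.
have [A2|N2] := pselect (attained 2); first exact: (build 2).
have [A1|N1] := pselect (attained 1).
  by apply: (build 1) => // -[|[|[|e]]].
have [ab0 _ _] := P0; have [d Hd d2] := gdist_ex ab0.
have Ad : attained d by exists a0, b0.
by apply: (build d) => //; case: d Ad {Hd d2} => [|[|[|d]]] // _ [|[|[|e]]].
Qed.

Lemma detour_wide g a b m g1 g2 : below w a b m -> m g1 != 0 -> m g2 != 0 ->
  detour_at a b g1 g2 -> src g = src a -> tgt g = tgt b -> folded_mult g = 2.
Proof.
move=> Hm m1 m2 sh Es Et; have [_ H] := Hm; have [on _ _] := oo.
have [E1 E2 E3 E4] := sh; have lt1 := src_lt_tgt g1; have lt2 := src_lt_tgt g2.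
have [ao1 ao2 bo1 bo2] := detour_ends_odd (H _ m1) (H _ m2) sh.
have [J1 J2] := (below_joined n_gt0 sx Hm, joinedC (below_joined n_gt0 sx (belowC Hm))).
have mid h : m h != 0 -> src h = n -> tgt h = n.+1 -> False.
  by move=> mh S T; apply: (middle_not_between n_gt0 sx oo S T ao1 ao2 bo1 bo2 J1 J2 (H _ mh)).
(* The center is n or n + 1 and neither step is the root from n to n + 1, so the detour starts
   before n and stops after n + 1. *)
have := mid _ m1; have := mid _ m2; rewrite E1 E2 E3 E4 => n2 n1.
apply: folded_mult_wide; rewrite ?Es ?Et.
  rewrite ltnNge; apply/negP => le_n; apply: n1; lia.
rewrite ltnNge; apply/negP => le_n; apply: n2; lia.
Qed.

Lemma rds_two g : is_rds w g 2 -> folded_mult g = 2.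
Proof.
case=> [[a [b [P [[_ //]|[_ [c [_ top ns le]] _]]]]] _].
have [ab _ wt_ab] := P; have [nsm wtm] := ns 0 isT.
have pr : prec w (c 0) (pair_seq a b) by rewrite -top; exact: le.
have Hm := prec_below n_gt0 sx ab pr wtm.
have [g1 [g2 [m1 m2 sh]]] := not_simple_detour Hm nsm.
have lta := src_lt_tgt a; have ltb := src_lt_tgt b.
have lt1 := src_lt_tgt g1; have lt2 := src_lt_tgt g2.
(* The detour follows the composed root: in the other direction it would have to stop at the label
   where it starts. *)
case: (pair_above_ends P) => -[E1 E2 E3]; case: sh => sh.
- exact: (detour_wide Hm m1 m2 sh).
- by case: sh; lia.
- by case: sh; lia.
- exact: (detour_wide (belowC Hm) m1 m2 sh).
Qed.

Lemma max_folded_multE : max_folded_mult n = 2.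
Proof.
apply/eqP; rewrite eqn_leq; apply/andP; split.
  by apply/bigmax_leqP => g _; exact: folded_mult_le.
have [||g s t] := @ends_ex n 0 n.*2.+1 => //.
by apply: leq_trans (leq_bigmax g); rewrite folded_mult_wide ?s ?t //; lia.
Qed.

End Detours.

Unset Implicit Arguments.

Theorem theorem6p16 (n : nat) (hn : (1 <= n)%N) (i0 : seq 'I_(n.*2.+1))
    (hi0 : twisted_adapted i0) :
  [/\ max_folded_mult n = 2
      /\ (forall a b : posroot n, a != b ->
            exists2 d, is_gdist i0 (pair_seq a b) d
                     & (d <= max_folded_mult n)%N),
      forall g : posroot n, ~ is_simple_root g ->
        (exists2 d, is_rds i0 g d & (d <= 2)%N)
        /\ (is_rds i0 g 2 -> folded_mult g = 2)
    & forall a b : posroot n, a != b ->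
        exists! s : {ffun posroot n -> nat}, is_soc i0 (pair_seq a b) s].
Proof.
have [xi sx] := twisted_adapted_sweep hn hi0.
have [o oo] := odd_label_ex hn sx.
split.
- rewrite (max_folded_multE hn); split=> // a b ab.
  exact: (gdist_ex hn sx oo ab).
- move=> g ng; split; first exact: (rds_ex hn sx oo ng).
  exact: (rds_two hn sx oo).
- by move=> a b ab; exact: (soc_ex_uniq hn sx ab).
Qed.
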